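(* Let $R$ be a noncommutative ring. (1) $R$ is $\eta_\ell$-elementary if and only if there exist a prime power $q$ and an integer $n\ge 1$ such that, as rings, $$R \cong \left\{ \begin{pmatrix} A & v \\ 0 & 0 \end{pmatrix} : A \in M_n(\mathbb{F}_q),\ v \in \mathbb{F}_q^n \right\} \subseteq M_{n+1}(\mathbb{F}_q).$$ In this case $\eta_\ell(R)=\frac{q^{n+1}-1}{q-1}$. (2) $R$ is $\eta_r$-elementary if and only if there exist a prime power $q$ and an integer $n\ge 1$ such that, as rings, $$R \cong \left\{ \begin{pmatrix} A & 0 \\ v^T & 0 \end{pmatrix} : A \in M_n(\mathbb{F}_q),\ v \in \mathbb{F}_q^n \right\} \subseteq M_{n+1}(\mathbb{F}_q).$$ In this case $\eta_r(R)=\frac{q^{n+1}-1}{q-1}$.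
   Context: Rings are associative, but not necessarily commutative and not necessarily unital. $\mathbb{F}_q$ is the finite field of order $q$, $M_n(\mathbb{F}_q)$ is the ring of $n\times n$ matrices over $\mathbb{F}_q$, and elements of $\mathbb{F}_q^n$ are viewed as column vectors. An ideal of $R$ is proper if it is different from $R$. For a ring $R$, $\eta_\ell(R)$ (resp. $\eta_r(R)$) is the minimum cardinality of a collection of proper left (resp. right) ideals of $R$ whose set-theoretic union equals $R$, and it is $\infty$ if no such collection exists. $R$ is $\eta_\ell$-elementary (resp. $\eta_r$-elementary) if $R$ is the union of finitely many proper left (resp. right) ideals and $\eta_\ell(R)<\eta_\ell(R/I)$ (resp. $\eta_r(R)<\eta_r(R/I)$) for every nonzero two-sided ideal $I$ of $R$ (where every integer is less than $\infty$). *)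

(* Defs.v *)
From HB Require Import structures.
From mathcomp Require Import all_boot all_order all_algebra.
From mathcomp Require Import mathcomp_extra boolp classical_sets functions.
From mathcomp Require Import cardinality.

Set Implicit Arguments.
Unset Strict Implicit.
Unset Printing Implicit Defensive.

Import GRing.Theory.
Local Open Scope classical_set_scope.
Local Open Scope card_scope.
Local Open Scope ring_scope.
Local Open Scope quotient_scope.

(* Every ring structure of MathComp is unital; this one is not. *)
HB.mixin Record Zmodule_isRng R of GRing.Zmodule R := {
  rmul : R -> R -> R;
  rmulA : associative rmul;
  rmulDl : left_distributive rmul +%R;
  rmulDr : right_distributive rmul +%R
}.

#[short(type="rngType")]
HB.structure Definition Rng := {R of GRing.Zmodule R & Zmodule_isRng R}.

Definition noncommutative (R : rngType) : Prop :=
  exists x y : R, rmul x y <> rmul y x.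

Section RngTheory.
Variable R : rngType.
Implicit Types x y z : R.

Lemma rmulBl x y z : rmul (x - y) z = rmul x z - rmul y z.
Proof. by apply/eqP; rewrite eq_sym subr_eq -rmulDl subrK. Qed.

Lemma rmulBr x y z : rmul x (y - z) = rmul x y - rmul x z.
Proof. by apply/eqP; rewrite eq_sym subr_eq -rmulDr subrK. Qed.

End RngTheory.

Definition left_ideal (R : rngType) (I : set R) : Prop :=
  [/\ I 0, forall x y, I x -> I y -> I (x - y)
    & forall a x, I x -> I (rmul a x)].

Definition right_ideal (R : rngType) (I : set R) : Prop :=
  [/\ I 0, forall x y, I x -> I y -> I (x - y)
    & forall a x, I x -> I (rmul x a)].

Record ideal (R : rngType) := Ideal {
  ideal_set :> set R;
  ideal_left : left_ideal ideal_set;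
  ideal_right : right_ideal ideal_set
}.

Definition nonzero_ideal (R : rngType) (I : ideal R) : Prop :=
  (I : set R) <> [set 0].

Definition ideal_pred (R : rngType) (I : ideal R) : {pred R} :=
  fun x => x \in (I : set R).

Section Quotient.
Variables (R : rngType) (I : ideal R).

Lemma ideal_predE x : (x \in ideal_pred I) = (x \in (I : set R)).
Proof. by []. Qed.

Lemma ideal_pred_zmod_closed : zmod_closed (ideal_pred I).
Proof.
case: (ideal_left I) => I0 IB _.
split; first by rewrite ideal_predE inE.
by move=> x y; rewrite !ideal_predE !inE; exact: IB.
Qed.

HB.instance Definition _ :=
  GRing.isZmodClosed.Build R (ideal_pred I) ideal_pred_zmod_closed.

Definition rng_quot := Quotient.quot (ideal_pred I).

HB.instance Definition _ := GRing.Zmodule.on rng_quot.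
HB.instance Definition _ := EqQuotient.on rng_quot.

Definition rng_quot_mul := lift_op2 rng_quot (@rmul R).

Lemma pi_rng_quot_mul :
  {morph \pi_rng_quot : x y / rmul x y >-> rng_quot_mul x y}.
Proof.
move=> x y; rewrite /rng_quot_mul; unlock; apply/eqP.
rewrite -Quotient.idealrBE ideal_predE inE.
set x' := repr _; set y' := repr _.
have hI (z : R) : (I : set R) (z - repr (\pi_rng_quot z)).
  have : z - repr (\pi_rng_quot z) \in ideal_pred I.
    by rewrite Quotient.idealrBE reprK.
  by rewrite ideal_predE inE.
have -> : rmul x y - rmul x' y' = rmul x (y - y') - rmul (x' - x) y'.
  by rewrite rmulBl rmulBr opprB addrA subrK.
have [I0 IB IL] := ideal_left I.
have [_ _ IR] := ideal_right I.
apply: (IB); first exact/IL/hI.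
by apply: IR; rewrite -opprB -sub0r; apply: IB => //; exact: hI.
Qed.

Lemma rng_quot_mulA : associative rng_quot_mul.
Proof.
move=> x y z; rewrite -[x]reprK -[y]reprK -[z]reprK.
by rewrite -!pi_rng_quot_mul rmulA.
Qed.

Lemma pi_rng_quot_add :
  {morph \pi_rng_quot : x y / x + y >-> (x + y : rng_quot)}.
Proof. exact: Quotient.pi_add. Qed.

Lemma rng_quot_mulDl : left_distributive rng_quot_mul (+%R : rng_quot -> _).
Proof.
move=> x y z; rewrite -[x]reprK -[y]reprK -[z]reprK.
by rewrite -pi_rng_quot_add -!pi_rng_quot_mul rmulDl pi_rng_quot_add.
Qed.

Lemma rng_quot_mulDr : right_distributive rng_quot_mul (+%R : rng_quot -> _).
Proof.
move=> x y z; rewrite -[x]reprK -[y]reprK -[z]reprK.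
by rewrite -pi_rng_quot_add -!pi_rng_quot_mul rmulDr pi_rng_quot_add.
Qed.

HB.instance Definition _ :=
  Zmodule_isRng.Build rng_quot rng_quot_mulA rng_quot_mulDl rng_quot_mulDr.

End Quotient.

(* [left_ideal] or [right_ideal], in the definitions below *)
Definition ideal_kind := forall R : rngType, set R -> Prop.

Definition proper_cover (J : ideal_kind) (R : rngType) (C : set (set R)) :=
  (forall I, C I -> J R I /\ I <> [set: R]) /\
  \bigcup_(I in C) I = [set: R].

Definition min_cover (J : ideal_kind) (R : rngType) (C : set (set R)) :=
  proper_cover J C /\ forall D, @proper_cover J R D -> C #<= D.

(* eta may be a natural number, an infinite cardinal, or oo (when there is no
   cover), so it is not given a value in a type: the relations below are
   "eta(R) = k" for a natural number k, and "eta(R) < eta(S)". *)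
Definition eta_eq (J : ideal_kind) (R : rngType) (k : nat) : Prop :=
  exists2 C : set (set R), min_cover J C & C #= `I_k.

(* eta(S) is the minimum of the cardinals of the covers D of S, and oo if there
   is none; oo < oo fails because R must have a cover. *)
Definition eta_lt (J : ideal_kind) (R S : rngType) : Prop :=
  exists2 C : set (set R), min_cover J C &
    forall D : set (set S), proper_cover J D -> C #<= D /\ ~ (D #<= C).

Definition eta_elementary (J : ideal_kind) (R : rngType) : Prop :=
  (exists2 C : set (set R), proper_cover J C & finite_set C) /\
  forall I : ideal R, nonzero_ideal I -> eta_lt J R (rng_quot I).

Definition rng_iso_subset (R : rngType) (M : pzRingType) (S : set M) : Prop :=
  exists f : R -> M, [/\ {morph f : x y / x + y >-> x + y},
    {morph f : x y / rmul x y >-> x * y} & set_bij [set: R] S f].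

Definition prime_power (q : nat) : Prop :=
  exists p k : nat, [/\ prime p, (0 < k)%N & q = (p ^ k)%N].

Definition col_extension (F : pzRingType) (n : nat) : set 'M[F]_(n + 1) :=
  [set block_mx A v 0 0 | A in [set: 'M[F]_n] & v in [set: 'cV[F]_n]].

Definition row_extension (F : pzRingType) (n : nat) : set 'M[F]_(n + 1) :=
  [set block_mx A 0 v^T 0 | A in [set: 'M[F]_n] & v in [set: 'cV[F]_n]].

Arguments col_extension F n : clear implicits.
Arguments row_extension F n : clear implicits.

(* Main.v *)
Require Import Defs.
From HB Require Import structures.
From mathcomp Require Import all_boot all_order all_algebra all_field.
From mathcomp Require Import mathcomp_extra boolp classical_sets functions.
From mathcomp Require Import cardinality.

(** Write [R_{n,m}] for the ring of matrices [X] of size [n] by [n + m] over a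
    finite field with product [X * Y = X' Y], where [X'] is the square matrix
    made of the first [n] columns of [X].  Deleting a zero row identifies the
    first ring of the theorem with [R_{n,1}].

    The ring [R_{n,1}] is elementary.  A left ideal of [R_{n,m}] is given by a
    space of rows, so a proper one lies in some [K_c = {X | X c = 0}] with
    [c <> 0] ([left_ideal_sub_annihilator]).
    For [m = 1] the [K_c] cover the ring, because [X] has more columns than
    rows; and each of them occurs in every cover, because [c] spans the kernel
    of some [X], which then lies in no other proper left ideal
    ([hyperplanes_min_cover]).  So the covering number is the number of lines
    in [F^(n+1)].  A nonzero two-sided ideal contains every matrix supported
    on the last column ([nonzero_ideal_socle]); modulo these there is an
    identity element, and a proper left ideal cannot contain it.

    Conversely let [R] be noncommutative and elementary, and take a cover of
    least size [k].  What is used is that no cover of size [k] is redundant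
    and that none has a nonzero two-sided ideal contained in all its members
    ([tight]).
    - [R] is finite: the members of an irredundant finite cover by subgroups
      meet in a subgroup of finite index, and a left ideal of finite index
      contains a two-sided ideal of finite index, which must be [0]
      ([tight_finite]).
    - Enlarge the members [L] to maximal left ideals and compare their
      annihilators [{x | x R <= L}], which are prime ideals.  If they were not
      all equal, the members with a given smallest annihilator could be
      separated from the other members by an element [e] that acts as [1] on
      [R / L] for the former and as [0] for the latter, and an element avoiding
      the whole cover could be glued together.  So the annihilators agree, the
      common value [P] satisfies [P R = 0], and [R] has a left identity
      ([tight_primitive]).
    - For a nonzero idempotent [f] with [f R] least, [f R f] is a division ring,
      hence a field by Wedderburn's little theorem.  A longest system of
      elements [u_i] in [R f] and [w_j] in [f R] with [w_j u_i = delta_ij f]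
      has [sum_i u_i w_i] as a left identity, and coordinates with respect to
      it turn [R] into some [R_{n,m}] ([tight_sandwich]).
    - [m = 0] would give an identity element.  If [m >= 2], a counting-free
      form of the Bose--Burton argument on points meeting all subspaces of
      codimension [n] turns the cover into one, of the same size, pulled back
      from the quotient [R_{n,1}], which is excluded ([tight_sandwich_width]).

    The statement on right ideals is the one on left ideals for the opposite
    ring, and transposition exchanges the two families of matrices. *)

Set Implicit Arguments.
Unset Strict Implicit.
Unset Printing Implicit Defensive.

Import GRing.Theory.
Local Open Scope classical_set_scope.
Local Open Scope card_scope.
Local Open Scope ring_scope.
Local Open Scope quotient_scope.

(** * Rings without unit *)

Section RngBasics.
Variable R : rngType.
Implicit Types (x y : R) (L : set R).

Lemma rmulr0 x : rmul x 0 = 0.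
Proof. by have := rmulBr x 0 0; rewrite !subrr. Qed.

Lemma rmul0r x : rmul 0 x = 0.
Proof. by have := rmulBl 0 0 x; rewrite !subrr. Qed.

Lemma rmulNr x y : rmul x (- y) = - rmul x y.
Proof. by rewrite -sub0r rmulBr rmulr0 sub0r. Qed.

Lemma rmulNl x y : rmul (- x) y = - rmul x y.
Proof. by rewrite -sub0r rmulBl rmul0r sub0r. Qed.

Lemma rmul_sumr (I : finType) x (F : I -> R) :
  rmul x (\sum_i F i) = \sum_i rmul x (F i).
Proof. exact: (big_morph (rmul x) (rmulDr x) (rmulr0 x)). Qed.

Lemma rmul_suml (I : finType) x (F : I -> R) :
  rmul (\sum_i F i) x = \sum_i rmul (F i) x.
Proof.
exact: (big_morph (rmul^~ x) (fun a b => rmulDl a b x) (rmul0r x)).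
Qed.

Definition subgroup L := L 0 /\ forall x y, L x -> L y -> L (x - y).

Section Subgroup.
Variables (L : set R) (sgL : subgroup L).

Lemma subg0 : L 0. Proof. by case: sgL. Qed.
Lemma subgB x y : L x -> L y -> L (x - y). Proof. by case: sgL => _; apply. Qed.
Lemma subgN x : L x -> L (- x).
Proof. by rewrite -sub0r; apply: subgB; exact: subg0. Qed.
Lemma subgD x y : L x -> L y -> L (x + y).
Proof. by move=> Lx Ly; rewrite -[y]opprK; apply/subgB/subgN. Qed.

Lemma subg_transl x y : L (x - y) -> L y -> L x.
Proof. by move=> Lxy Ly; rewrite -(subrK y x); apply: subgD. Qed.

Lemma subg_sym x y : L (x - y) -> L (y - x).
Proof. by move=> Lxy; rewrite -opprB; apply: subgN. Qed.

Lemma subg_trans y x z : L (x - y) -> L (y - z) -> L (x - z).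
Proof.
by move=> Lxy Lyz; rewrite -(subrK y x) -addrA; apply: subgD.
Qed.
End Subgroup.

Lemma left_ideal_subgroup L : left_ideal L -> subgroup L.
Proof. by case. Qed.

Lemma right_ideal_subgroup L : right_ideal L -> subgroup L.
Proof. by case. Qed.

Lemma left_idealM L a x : left_ideal L -> L x -> L (rmul a x).
Proof. by case=> _ _; apply. Qed.

End RngBasics.

(** * Covers indexed by ordinals *)

(** These properties are all that left and right ideals need to have in common
    for covers to be moved between [R] and its quotients. *)
Record quotient_stable (J : ideal_kind) : Prop := QuotientStable {
  qs_subgroup : forall (R : rngType) (L : set R), J R L -> subgroup L;
  qs_image : forall (R : rngType) (I : ideal R) (L : set R),
    J R L -> J (rng_quot I) (\pi_(rng_quot I) @` L);
  qs_preimage : forall (R : rngType) (I : ideal R) (L : set (rng_quot I)),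
    J (rng_quot I) L -> J R (\pi_(rng_quot I) @^-1` L)
}.

Lemma pi_rng_quot_eq (R : rngType) (I : ideal R) (x y : R) :
  \pi_(rng_quot I) x = \pi_(rng_quot I) y <-> (I : set R) (x - y).
Proof.
split=> [e|Ixy]; last first.
  by apply/eqP; rewrite -Quotient.idealrBE ideal_predE inE.
have : x - y \in ideal_pred I by rewrite Quotient.idealrBE; apply/eqP.
by rewrite ideal_predE inE.
Qed.

Lemma pi_rng_quotB (R : rngType) (I : ideal R) :
  {morph \pi_(rng_quot I) : x y / x - y >-> x - y}.
Proof.
move=> x y; apply/eqP; rewrite eq_sym subr_eq -pi_rng_quot_add.
by rewrite subrK.
Qed.

Lemma pi_rng_quot0 (R : rngType) (I : ideal R) : \pi_(rng_quot I) 0 = 0.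
Proof. by rewrite -(subrr 0) pi_rng_quotB subrr. Qed.

Lemma pi_rng_quot_surj (R : rngType) (I : ideal R) (z : rng_quot I) :
  exists x, \pi_(rng_quot I) x = z.
Proof. by exists (repr z); rewrite reprK. Qed.

Lemma left_ideal_quotient_stable : quotient_stable left_ideal.
Proof.
split=> [R L|R I L [L0 LB LM]|R I L [L0 LB LM]].
- exact: left_ideal_subgroup.
- split; first by exists 0 => //; exact: pi_rng_quot0.
  + by move=> _ _ [x Lx <-] [y Ly <-]; exists (x - y);
    [exact: LB|exact: pi_rng_quotB].
  + move=> a _ [x Lx <-]; have [b <-] := pi_rng_quot_surj a.
    by exists (rmul b x); [exact: LM|exact: pi_rng_quot_mul].
- split=> [|x y|a x] /=; first by rewrite pi_rng_quot0.
  + by rewrite pi_rng_quotB; apply: LB.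
  + by rewrite pi_rng_quot_mul; apply: LM.
Qed.

Lemma right_ideal_quotient_stable : quotient_stable right_ideal.
Proof.
split=> [R L|R I L [L0 LB LM]|R I L [L0 LB LM]].
- exact: right_ideal_subgroup.
- split; first by exists 0 => //; exact: pi_rng_quot0.
  + by move=> _ _ [x Lx <-] [y Ly <-]; exists (x - y);
    [exact: LB|exact: pi_rng_quotB].
  + move=> a _ [x Lx <-]; have [b <-] := pi_rng_quot_surj a.
    by exists (rmul x b); [exact: LM|exact: pi_rng_quot_mul].
- split=> [|x y|a x] /=; first by rewrite pi_rng_quot0.
  + by rewrite pi_rng_quotB; apply: LB.
  + by rewrite pi_rng_quot_mul; apply: LM.
Qed.

Definition covers (J : ideal_kind) (R : rngType) k (H : 'I_k -> set R) :=
  (forall i, J R (H i) /\ H i <> [set: R]) /\ (forall x, exists i, H i x).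

Definition irredundant (T : Type) k (H : 'I_k -> set T) :=
  forall i, exists x, forall j, j <> i -> ~ H j x.

(** The part of being elementary that the classification uses, with [k] the
    covering number.  Covers of a quotient [R / I] appear as covers of [R] by
    ideals that contain [I]. *)
Definition tight (J : ideal_kind) (R : rngType) k :=
  [/\ exists H : 'I_k -> set R, covers J H,
      forall H : 'I_k -> set R, covers J H -> irredundant H
    & forall (I : ideal R) (H : 'I_k -> set R), nonzero_ideal I ->
      covers J H -> ~ forall i, I `<=` H i].

Lemma range_ord_card_le (T : Type) k (H : 'I_k -> T) (A : set 'I_k) :
  H @` A #<= `I_k.
Proof.
apply: card_le_trans (card_image_le _ _) _.
apply: card_le_trans (card_leT _) _.
by have := @card_II k; rewrite card_eq_le => /andP[].
Qed.

Lemma eta_elementary_tight (J : ideal_kind) (R : rngType) :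
  quotient_stable J -> eta_elementary J R ->
  (exists I : ideal R, nonzero_ideal I) -> exists k, tight J R k.
Proof.
move=> qsJ [[C0 covC0 finC0] lt] [I0 nzI0].
(* Each instance of [lt] comes with its own minimal cover, but all of them are
   equipotent to [C1]. *)
have [C1 [covC1 minC1] _] := lt _ nzI0.
have /finite_setP[k C1k] : finite_set C1.
  exact: card_le_finite (minC1 _ covC0) finC0.
have rangeC k' (H : 'I_k' -> set R) : covers J H -> C1 #<= range H.
  move=> [JH cH]; apply: minC1; split=> [_ [i _ <-]|]; first exact: JH.
  rewrite -subTset => x _; have [i Hx] := cH x.
  by exists (H i) => //; exists i.
exists k; split.
- have [f [fC _ fS]] : exists f : nat -> set R, set_bij `I_k C1 f.
    by apply/card_set_bijP; rewrite card_eq_sym.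
  exists (fun i : 'I_k => f i); split=> [i|x].
    by have [JC _] := covC1; apply: JC; apply: fC => /=.
  have : [set: R] x by [].
  rewrite -(covC1.2) => -[L C1L Lx]; have [i /= ik fi] := fS _ C1L.
  by exists (Ordinal ik) => /=; rewrite fi.
- move=> H covH i; apply: contrapT => nH.
  have /rangeC le : covers J (fun j => H (lift i j)).
    split=> [j|x]; first exact: covH.1.
    apply: contrapT => nx; apply: nH; exists x => j /eqP ji Hjx.
    move: ji; rewrite eq_sym => /unlift_some[j' e _].
    by apply: nx; exists j'; rewrite -e.
  have : `I_k #<= `I_k.-1.
    rewrite -(card_le_eql C1k); exact: card_le_trans le (range_ord_card_le _ _).
  by rewrite card_le_II leqNgt prednK ?leqnn // (leq_ltn_trans _ (ltn_ord i)).
- move=> I H nzI [JH cH] IH.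
  have [C [covC minC] nD] := lt I nzI.
  pose piI := \pi_(rng_quot I).
  pose D := range (fun i => piI @` H i).
  have [|_] := nD D; last apply.
    split=> [_ [i _ <-]|].
      have [JHi Hi] := JH i; split; first exact: qs_image.
      move=> e; apply: Hi; rewrite -subTset => x _.
      have : (piI @` H i) (piI x) by rewrite e.
      move=> [y Hy /pi_rng_quot_eq Iyx].
      apply: (subg_transl (qs_subgroup qsJ JHi)) Hy.
      apply/(subg_sym (qs_subgroup qsJ JHi)).
      exact: IH Iyx.
    rewrite -subTset => z _; have [x <-] := pi_rng_quot_surj z.
    have [i Hx] := cH x; exists (piI @` H i); first by exists i.
    by exists x.
  apply: card_le_trans (range_ord_card_le _ _) _.
  rewrite -(card_le_eql C1k).
  exact: minC1.
Qed.

Lemma eta_elementary_of_no_cover (J : ideal_kind) (R : rngType)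
    (C : set (set R)) :
  quotient_stable J -> min_cover J C -> finite_set C ->
  (forall (I : ideal R) (D : set (set R)), nonzero_ideal I ->
     proper_cover J D -> ~ forall L, D L -> I `<=` L) ->
  eta_elementary J R.
Proof.
move=> qsJ minC finC noD; split=> [|I nzI]; first by exists C => //; case: minC.
exists C => // D [JD cD]; exfalso.
pose piI := \pi_(rng_quot I).
apply: (noD I ((fun L => piI @^-1` L) @` D) nzI).
  split=> [_ [L DL <-]|].
    have [JL nL] := JD L DL; split; first exact: qs_preimage.
    move=> e; apply: nL; rewrite -subTset => z _.
    have [x <-] := pi_rng_quot_surj z.
    by have : (piI @^-1` L) x by rewrite e.
  rewrite -subTset => x _; have : [set: rng_quot I] (piI x) by [].
  by rewrite -cD => -[L DL Lx]; exists (piI @^-1` L) => //; exists L.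
move=> _ [L DL <-] x Ix /=.
have [/(qs_subgroup qsJ)[L0 _] _] := JD L DL.
suff -> : piI x = 0 by [].
by rewrite -(pi_rng_quot0 I); apply/pi_rng_quot_eq; rewrite subr0.
Qed.

(** * Finiteness *)

(** By downward induction on [S], the intersection [H_S] of the [H i] with [i]
    in [S] is a finite union of cosets of the intersection of all the [H i].
    If [j] is not in [S] and [a] lies in no [H i] with [i] in [S], then
    [H_S + a] avoids these [H i], hence lies in the union of the others, and
    [H_S] meets the translate [H i - a], if at all, in a coset of [H_S]
    intersected with [H i]. *)
Lemma irredundant_cover_finite_index (R : rngType) k (H : 'I_k -> set R) :
  (forall i, subgroup (H i)) -> (forall x, exists i, H i x) -> irredundant H ->
  exists s : seq R, forall x, exists2 t, t \in s & forall i, H i (x - t).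
Proof.
move=> sgH covH irrH.
suff main n : forall S : {set 'I_k}, #|~: S| = n ->
    exists s : seq R, forall x, (forall i, i \in S -> H i x) ->
      exists2 t, t \in s & forall i, H i (x - t).
  have [s hs] := main _ finset.set0 erefl; exists s => x; apply: hs => i.
  by rewrite finset.inE.
elim: n => [|n IHn] S cS.
  exists [:: 0] => x HS; exists 0; rewrite ?mem_head // => i; rewrite subr0.
  apply: HS; move/eqP: cS; rewrite cards_eq0 => /eqP SC0.
  by rewrite -[S]finset.setCK SC0 finset.setC0 finset.inE.
have [j jS] : exists j, j \in ~: S by apply/card_gt0P; rewrite cS.
have [a nHa] := irrH j.
have Sa i : i \in S -> ~ H i a.
  by move=> iS; apply: nHa => ij; move: jS; rewrite -ij finset.inE iS.
have step i : exists s : seq R, i \notin S -> forall x,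
    (forall i, i \in S -> H i x) -> H i (x + a) ->
    exists2 t, t \in s & forall i, H i (x - t).
  have [iS|iS] := boolP (i \in S); first by exists [::].
  have [|s hs] := IHn (i |: S).
    move: (cardsC S) (cardsC (i |: S)); rewrite cS cardsU1 iS.
    by rewrite -addSnnS add1n => <- /eqP; rewrite eqn_add2l => /eqP.
  have [[y HSy Hiy]|noy] := pselect
    (exists2 y, (forall i, i \in S -> H i y) & H i (y + a)); last first.
    by exists [::] => _ x HSx Hix; case: noy; exists x.
  exists [seq y + t | t <- s] => _ x HSx Hix.
  have [l|t ts Ht] := hs (x - y); first rewrite !finset.inE => /orP[/eqP->|lS].
  - have -> : x - y = (x + a) - (y + a) by rewrite opprD addrACA subrr addr0.
    exact: subgB.
  - by apply: subgB; auto.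
  - by exists (y + t); [exact: map_f|move=> l; rewrite opprD addrA].
have [f hf] := choice step.
exists (flatten [seq f i | i <- enum 'I_k]) => x HSx.
have [i Hi] := covH (x + a).
have iS : i \notin S.
  apply/negP => iS; apply: (Sa i iS).
  by rewrite -(addrK x a) [a + x]addrC; apply: subgB => //; exact: HSx.
have [t tf Ht] := hf i iS x HSx Hi.
by exists t => //; apply/flattenP; exists (f i) => //; apply/map_f; rewrite mem_enum.
Qed.

(** The largest two-sided ideal contained in the left ideal [D]. *)
Section Core.
Variables (R : rngType) (D : set R) (idD : left_ideal D).

Definition core : set R := [set x | D x /\ forall r, D (rmul x r)].

Lemma core_left : left_ideal core.
Proof.
have sgD := left_ideal_subgroup idD; split.
- split=> [|r]; first exact: subg0.
  by rewrite rmul0r; apply: subg0.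
- move=> x y [Dx DxR] [Dy DyR]; split=> [|r]; first exact: subgB.
  by rewrite rmulBl; apply: subgB.
- move=> a x [Dx DxR]; split=> [|r]; first exact: left_idealM.
  by rewrite -rmulA; apply: left_idealM.
Qed.

Lemma core_right : right_ideal core.
Proof.
have [c0 cB _] := core_left; split=> // a x [_ DxR]; split=> // r.
by rewrite -rmulA.
Qed.

Definition core_ideal := Ideal core_left core_right.

(** If [s] is a transversal of [D], an element is determined modulo [core] by
    the classes modulo [D] of [x] and of the [x t] with [t] in [s]. *)
Lemma finite_rng_of_core (s : seq R) :
  (forall x, exists2 t, t \in s & D (x - t)) -> core `<=` [set 0] ->
  finite_set [set: R].
Proof.
move=> hs c0; have sgD := left_ideal_subgroup idD.
have hs' x : exists t : seq_sub s, D (x - val t).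
  by have [t ts Dt] := hs x; exists (SeqSub ts).
have [tau htau] := choice hs'.
pose g x : {ffun option (seq_sub s) -> seq_sub s} := [ffun o : option (seq_sub s) =>
  if o is Some t then tau (rmul x (val t)) else tau x].
suff ginj : injective g.
  rewrite -(eq_finite_set (inj_card_eq (in2W ginj : {in [set: R] &, _}))).
  exact: finite_finset.
move=> x y gxy.
have tauD u v : tau u = tau v -> D (u - v).
  move=> e; apply: (subg_trans sgD (htau u)).
  by rewrite e; apply: (subg_sym sgD).
apply/eqP; rewrite -subr_eq0; apply/eqP; apply: c0; split.
  by apply: tauD; move/ffunP/(_ None): gxy; rewrite !ffunE.
move=> r; have [t ts Drt] := hs r.
rewrite -(subrK t r) rmulDr; apply: subgD => //; first exact: left_idealM.
rewrite rmulBl; apply: tauD.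
by move/ffunP/(_ (Some (SeqSub ts))): gxy; rewrite !ffunE.
Qed.
End Core.

Lemma bigcap_left_ideal (R : rngType) k (H : 'I_k -> set R) :
  (forall i, left_ideal (H i)) -> left_ideal [set x | forall i, H i x].
Proof.
move=> idH; split=> [i|x y Hx Hy i|a x Hx i].
- by have [] := idH i.
- by have [_ HB _] := idH i; apply: HB.
- by have [_ _ HM] := idH i; apply: HM.
Qed.

Lemma tight_finite (R : rngType) k : tight left_ideal R k -> finite_set [set: R].
Proof.
case=> -[H covH] irr noI; have irrH := irr H covH.
have idH i : left_ideal (H i) by have [] := covH.1 i.
have [s hs] := irredundant_cover_finite_index
  (fun i => left_ideal_subgroup (idH i)) covH.2 irrH.
apply: (finite_rng_of_core (bigcap_left_ideal idH) hs).
apply: contrapT => nz; apply: (noI (core_ideal (bigcap_left_ideal idH)) H) => //.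
  by move=> e; apply: nz; rewrite /core_ideal /= in e *; rewrite e.
by move=> i x [Dx _]; exact: Dx.
Qed.

#[short(type="finRngType")]
HB.structure Definition FinRng := {R of Rng R & Finite R}.

Lemma finite_rng_finRngType (R : rngType) : finite_set [set: R] ->
  exists R' : finRngType, (R' : rngType) = R.
Proof.
move=> /finite_seqP[s hs].
have mem_s (x : R) : x \in undup s.
  by rewrite mem_undup; have : [set: R] x by []; rewrite hs.
have pK : pcancel (fun x : R => index x (undup s)) (onth (undup s)).
  by move=> x; rewrite onthE (nth_map x) ?index_mem // nth_index.
pose cC := Choice_isCountable.Build R pK.
pose cR : countType := HB.pack (Rng.sort R) cC.
have fax : finite_axiom (undup s : seq cR).
  by move=> x; rewrite count_uniq_mem ?undup_uniq // mem_s.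
pose fC := isFinite.Build cR fax.
pose fR : finRngType := HB.pack (Rng.sort R) cC fC.
by exists fR; unfold fR, fC, cR, cC; destruct R as [T []].
Qed.

(** * Maximal left ideals of finite rings *)

Lemma exists_max (T : Type) (P : T -> Prop) (m : T -> nat) B :
  (exists x, P x) -> (forall x, P x -> (m x <= B)%N) ->
  exists2 x, P x & forall y, P y -> (m y <= m x)%N.
Proof.
move=> [x0 Px0] mB; pose Q n := `[< exists2 x, P x & m x = n >].
have exQ : exists n, Q n by exists (m x0); apply/asboolP; exists x0.
have QB n : Q n -> (n <= B)%N by move=> /asboolP[x Px <-]; exact: mB.
case: (ex_maxnP exQ QB) => n /asboolP[x Px <-] maxx.
by exists x => // y Py; apply: maxx; apply/asboolP; exists y.
Qed.

Lemma exists_min (T : Type) (P : T -> Prop) (m : T -> nat) :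
  (exists x, P x) -> exists2 x, P x & forall y, P y -> (m x <= m y)%N.
Proof.
move=> [x0 Px0]; pose Q n := `[< exists2 x, P x & m x = n >].
have exQ : exists n, Q n by exists (m x0); apply/asboolP; exists x0.
case: (ex_minnP exQ) => n /asboolP[x Px <-] minx.
by exists x => // y Py; apply: minx; apply/asboolP; exists y.
Qed.

Section FiniteSets.
Variable T : finType.
Implicit Types A B : set T.

Definition csize A := #|[pred x | x \in A]|.

Lemma csizeS A B : A `<=` B -> (csize A <= csize B)%N.
Proof.
move=> AB; apply/subset_leq_card/fintype.subsetP => x.
by rewrite !inE; exact: AB.
Qed.

Lemma csize_lt A B x : A `<=` B -> B x -> ~ A x -> (csize A < csize B)%N.
Proof.
move=> AB Bx nAx; apply/proper_card/fintype.properP; split.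
  by apply/fintype.subsetP => y; rewrite !inE; exact: AB.
by exists x; rewrite !inE //; apply/negP; rewrite inE.
Qed.

Lemma csize_eq A B : A `<=` B -> (csize B <= csize A)%N -> A = B.
Proof.
move=> AB le; apply/seteqP; split=> // x Bx; apply: contrapT => nAx.
by have := csize_lt AB Bx nAx; rewrite ltnNge le.
Qed.

Lemma csize_max A : (csize A <= #|T|)%N.
Proof. exact: max_card. Qed.
End FiniteSets.

Section FiniteRng.
Variable R : finRngType.
Implicit Types (x y r : R) (A L : set R).

(** In a minimal closed subset [S], any [x] satisfies [S x = S]; so [x = y x]
    for some [y], the [y] with this property form a closed subset, and [x] is
    one of them. *)
Lemma semigroup_idempotent (P : set R) x0 : P x0 ->
  (forall x y, P x -> P y -> P (rmul x y)) -> exists2 g, P g & rmul g g = g.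
Proof.
move=> Px0 PM.
pose sub (S : set R) :=
  [/\ S `<=` P, (exists x, S x) & forall x y, S x -> S y -> S (rmul x y)].
have [|S [SP [x Sx] SM] minS] := @exists_min _ sub (@csize R).
  by exists P; split=> //; exists x0.
have minE (S' : set R) : sub S' -> S' `<=` S -> S' = S.
  by move=> sS' S'S; apply: csize_eq => //; exact: minS.
have Sx_sub : (rmul^~ x) @` S `<=` S by move=> _ [y Sy <-]; exact: SM.
have SxE : (rmul^~ x) @` S = S.
  apply: minE => //; split; first exact: subset_trans Sx_sub SP.
    by exists (rmul x x); exists x.
  move=> _ _ [a Sa <-] [b Sb <-]; exists (rmul (rmul a x) b).
    by apply: (SM) => //; exact: SM.
  by rewrite rmulA.
have [y Sy yx] : ((rmul^~ x) @` S) x by rewrite SxE.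
pose Y := [set z | S z /\ rmul z x = x].
have YE : Y = S.
  apply: minE => [|z []//]; split=> [z [Sz _]|| a b [Sa ax] [Sb bx]].
  - exact: SP.
  - by exists y.
  - by split; [exact: SM|rewrite -rmulA bx].
have [_ xx] : Y x by rewrite YE.
by exists x => //; exact: SP.
Qed.

Definition maximal_left_ideal L :=
  [/\ left_ideal L, L <> [set: R] &
      forall K : set R, left_ideal K -> L `<=` K -> K = L \/ K = [set: R]].

Lemma maximal_left_ideal_exists L : left_ideal L -> L <> [set: R] ->
  exists2 M, maximal_left_ideal M & L `<=` M.
Proof.
move=> idL nL.
pose P (M : set R) := [/\ left_ideal M, M <> [set: R] & L `<=` M].
have [||M [idM nM LM] maxM] := @exists_max _ P (@csize R) #|R|.
- by exists L; split.
- by move=> *; exact: csize_max.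
exists M => //; split=> // K idK MK.
have [->|nK] := pselect (K = [set: R]); first by right.
left; apply/esym/csize_eq => //; apply: maxM; split=> //.
exact: subset_trans MK.
Qed.

Definition two_sided A := left_ideal A /\ right_ideal A.

(** The annihilator of the left module [R / L]. *)
Definition colon L : set R := [set x | forall r, L (rmul x r)].

Lemma colon_two_sided L : left_ideal L -> two_sided (colon L).
Proof.
move=> idL; have sgL := left_ideal_subgroup idL; split; split.
- by move=> r; rewrite rmul0r; exact: subg0.
- by move=> x y Cx Cy r; rewrite rmulBl; apply: subgB.
- by move=> a x Cx r; rewrite -rmulA; apply: left_idealM.
- by move=> r; rewrite rmul0r; exact: subg0.
- by move=> x y Cx Cy r; rewrite rmulBl; apply: subgB.
- by move=> a x Cx r; rewrite -rmulA.
Qed.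

Lemma two_sided_setT : two_sided [set: R].
Proof. by []. Qed.

(** [R / L] is simple as a module over any two-sided ideal [A] that does not
    annihilate it: the elements [A y + L] form a left ideal, which is [R]
    unless [A y] is contained in [L], and the [y] of this last kind form a left
    ideal too. *)
Lemma maximal_generate L A y : maximal_left_ideal L -> two_sided A ->
  ~ A `<=` colon L -> ~ L y -> forall x, exists2 a, A a & L (x - rmul a y).
Proof.
move=> [idL nL maxL] [[A0 AB AMl] [_ _ AMr]] nA nLy x.
have sgL := left_ideal_subgroup idL.
pose K := [set x | exists2 a, A a & L (x - rmul a y)].
have idK : left_ideal K.
  split=> [|u v [a Aa La] [b Ab Lb]|c u [a Aa La]].
  - by exists 0; rewrite // rmul0r subrr; exact: subg0.
  - exists (a - b); first exact: AB.
    by rewrite rmulBl opprD addrACA -opprD; apply: subgB.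
  - exists (rmul c a); first exact: AMl.
    by rewrite -rmulA -rmulBr; apply: left_idealM.
have LK : L `<=` K by move=> u Lu; exists 0; rewrite // rmul0r subr0.
have [KL|KT] := maxL _ idK LK; last by have : K x by rewrite KT.
exfalso; apply: nA => a Aa r.
have Ay b : A b -> L (rmul b y).
  by move=> Ab; rewrite -KL; exists b; rewrite // subrr; exact: subg0.
pose N := [set u | forall b, A b -> L (rmul b u)].
have idN : left_ideal N.
  split=> [b _|u v Nu Nv b Ab|c u Nu b Ab].
  - by rewrite rmulr0; exact: subg0.
  - by rewrite rmulBr; apply: subgB => //; [exact: Nu|exact: Nv].
  - by rewrite rmulA; apply: Nu; exact: AMr.
have LN : L `<=` N by move=> u Lu b _; exact: left_idealM.
have [NL|NT] := maxL _ idN LN; first by exfalso; apply: nLy; rewrite -NL.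
by have /(_ a Aa) : N r by rewrite NT.
Qed.

(** Idempotents of [A] whose fixed space in [R / L] is not everything can be
    enlarged by an orthogonal one, so that a largest one fixes [R / L]. *)
Lemma local_left_identity L A : maximal_left_ideal L -> two_sided A ->
  ~ A `<=` colon L -> exists2 e, A e & forall r, L (rmul e r - r).
Proof.
move=> maxL tA nA; have [idL _ _] := maxL.
have [[A0 AB AMl] [_ _ AMr]] := tA.
have sgA : subgroup A by split.
have sgL := left_ideal_subgroup idL.
pose fixs f : set R := [set r | L (rmul f r - r)].
pose P f := A f /\ rmul f f = f.
have [||f [Af ff] maxf] := @exists_max _ P (fun f => csize (fixs f)) #|R|.
- by exists 0; split=> //; rewrite rmulr0.
- by move=> *; exact: csize_max.
exists f => // r; apply: contrapT => nLr.
have [k nLk fk] : exists2 k, ~ L k & rmul f k = 0.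
  exists (r - rmul f r); first by move=> /(subg_sym sgL).
  by rewrite rmulBr rmulA ff subrr.
have [a Aa La] := maximal_generate maxL tA nA nLk k.
pose Q g := [/\ A g, rmul f g = 0, rmul g f = 0 & L (rmul g k - k)].
(* [b] is [(1 - f) a (1 - f)]. *)
pose b := (a - rmul f a) - (rmul a f - rmul f (rmul a f)).
have Qb : Q b.
  rewrite /Q /b; split.
  - apply: (AB); apply: (AB) => //; [exact: AMl|exact: AMr|].
    by apply: AMl; exact: AMr.
  - by rewrite !rmulBr !rmulA ff !subrr.
  - by rewrite !rmulBl -!rmulA ff !subrr.
  - rewrite !rmulBl -!rmulA fk !rmulr0 !subr0.
    have -> : rmul a k - rmul f (rmul a k) - k =
              rmul f (k - rmul a k) - (k - rmul a k).
      by rewrite rmulBr fk sub0r opprB addrCA addrA.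
    by apply: subgB => //; exact: left_idealM.
have [|g [Ag fg gf Lg] gg] := semigroup_idempotent Qb.
  move=> x y [Ax fx xf Lx] [Ay fy yf Ly]; split.
  - exact: AMl.
  - by rewrite rmulA fx rmul0r.
  - by rewrite -rmulA yf rmulr0.
  - apply: (subg_trans sgL (y := rmul x k)) => //.
    by rewrite -rmulA -rmulBr; apply: left_idealM.
have /maxf : P (f + g).
  split; first exact: subgD.
  by rewrite rmulDl !rmulDr ff fg gf gg addr0 add0r.
rewrite leqNgt => /negP; apply.
apply: (@csize_lt _ _ _ k) => [x Lx||].
- rewrite /fixs /= rmulDl addrAC; apply: subgD => //.
  rewrite -[rmul g x]subr0 -(rmul0r x) -gf -rmulA -rmulBr.
  apply: left_idealM => //; exact: subg_sym.
- by rewrite /fixs /= rmulDl fk add0r.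
- by rewrite /fixs /= fk sub0r => /(subgN sgL); rewrite opprK.
Qed.

(** If [b r] is not in [L], then neither is [a b r] for some [a] in [A], by
    [maximal_generate]: the annihilator of a simple module is prime. *)
Lemma colon_prime L A B : maximal_left_ideal L -> two_sided A ->
  two_sided B -> ~ A `<=` colon L -> ~ B `<=` colon L ->
  ~ A `&` B `<=` colon L.
Proof.
move=> maxL tA tB nA nB nAB; apply: nB => b Bb r; apply: contrapT => nLbr.
have [idL _ _] := maxL; have sgL := left_ideal_subgroup idL.
have [a Aa La] := maximal_generate maxL tA nA nLbr (rmul b r).
apply: nLbr; apply: (subg_transl sgL La).
rewrite rmulA; apply: nAB; split.
- by case: tA => _ [_ _ AM]; exact: AM.
- by case: tB => -[_ _ BM] _; exact: BM.
Qed.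

Lemma colon_prime_bigcap L k (P : pred 'I_k) (A : 'I_k -> set R) :
  maximal_left_ideal L -> ~ [set: R] `<=` colon L ->
  (forall i, two_sided (A i)) -> (forall i, P i -> ~ A i `<=` colon L) ->
  exists2 B, two_sided B & ~ B `<=` colon L /\ forall i, P i -> B `<=` A i.
Proof.
move=> maxL nT tA nA.
suff main (s : seq 'I_k) : exists2 B, two_sided B &
    ~ B `<=` colon L /\ forall i, i \in s -> P i -> B `<=` A i.
  have [B tB [nB BA]] := main (enum 'I_k); exists B => //; split=> // i.
  by apply: BA; rewrite mem_enum.
elim: s => [|j s [B tB [nB BA]]]; first by exists [set: R].
have [Pj|nPj] := boolP (P j); last first.
  exists B => //; split=> // i; rewrite inE => /orP[/eqP->|/BA//].
  by rewrite (negbTE nPj).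
exists (B `&` A j).
  have [[B0 BB BM] [_ _ BM']] := tB; have [[A0 AB AM] [_ _ AM']] := tA j.
  split; split=> //.
  - by move=> x y [Bx Ax] [By Ay]; split; [exact: BB|exact: AB].
  - by move=> a x [Bx Ax]; split; [exact: BM|exact: AM].
  - by move=> x y [Bx Ax] [By Ay]; split; [exact: BB|exact: AB].
  - by move=> a x [Bx Ax]; split; [exact: BM'|exact: AM'].
split; first by apply: colon_prime => //; exact: nA.
move=> i; rewrite inE => /orP[/eqP-> _ x []//|si Pi x [Bx _]].
exact: BA si Pi x Bx.
Qed.

(** Besides the left identity [e], this says that an element annihilating the
    simple module [R / L] annihilates [R] from the left: up to elements with
    this property, [R] is primitive. *)
Definition left_primitive (e : R) L :=
  [/\ forall r, rmul e r = r, maximal_left_ideal L &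
      forall x, (forall r, L (rmul x r)) -> forall r, rmul x r = 0].

(** The members [H i] whose annihilator [P i] is a fixed smallest one, [P i0],
    are separated from the others by an element [e] of the intersection of the
    other annihilators acting as [1] on [R / H i0].  If [u] is missed by the
    former members and [v] by the latter, [v + e (u - v)] is missed by all. *)
Lemma tight_primitive k : tight left_ideal R k -> noncommutative R ->
  exists e L, left_primitive e L.
Proof.
case=> -[H0 [idH0 covH0]] irr noI ncR.
have maxH i : exists M, maximal_left_ideal M /\ H0 i `<=` M.
  have [idi ni] := idH0 i; have [M] := maximal_left_ideal_exists idi ni.
  by exists M.
have {maxH}[H HP] := choice maxH.
have maxH i : maximal_left_ideal (H i) by have [] := HP i.
have idH i : left_ideal (H i) by have [] := maxH i.
have sgH i := left_ideal_subgroup (idH i).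
have covH : covers left_ideal H.
  split=> [i|x]; first by have [] := maxH i.
  by have [i Hi] := covH0 x; exists i; have [_] := HP i; apply.
have irrH := irr H covH.
pose P i := colon (H i); have tP i : two_sided (P i) := colon_two_sided (idH i).
(* Otherwise all products are in all members, so the ideal contained in all
   members is nonzero by noncommutativity. *)
have [i1 nPi1] : exists i, P i <> [set: R].
  apply: contrapT => noi; have RRH i x y : H i (rmul x y).
    have PT : P i = [set: R] by apply: contrapT => ni; apply: noi; exists i.
    by have : P i x by rewrite PT.
  have idD := bigcap_left_ideal idH.
  have [rI lI] : left_ideal [set x | forall i, H i x] /\
                 right_ideal [set x | forall i, H i x].
    by split=> //; case: idD => D0 DB DM; split=> // a x Dx i.
  apply: (noI (Ideal rI lI) H) => //.
    have [x [y xy]] := ncR => e; apply: xy.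
    have : (Ideal rI lI : set R) (rmul x y) by move=> i.
    have : (Ideal rI lI : set R) (rmul y x) by move=> i.
    by rewrite e => -> ->.
  by move=> i x; apply.
have [i0 _ mini0] :=
  @exists_min _ (fun i => True) (fun i => csize (P i)) (ex_intro _ i1 I).
have nPi0 : ~ [set: R] `<=` P i0.
  move=> TP; apply: nPi1; rewrite -subTset => x Tx.
  suff -> : P i1 = [set: R] by [].
  apply: csize_eq => //; apply: leq_trans (mini0 i1 I); exact: csizeS.
have neqP i : P i <> P i0 -> ~ P i `<=` P i0.
  by move=> ni Pi; apply: ni; apply: csize_eq => //; exact: mini0.
have [B tB [nB BP]] := @colon_prime_bigcap (H i0) k
  (fun i => `[< P i <> P i0 >]) P (maxH i0) nPi0 tP
  (fun i Pi => neqP i (asboolW Pi)).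
have [e Be eH] := local_left_identity (maxH i0) tB nB.
have PE i r : P i = P i0 -> H i (rmul e r - r).
  move=> Pi.
  have nRi : ~ [set: R] `<=` colon (H i) by rewrite -/(P i) Pi.
  apply: contrapT => nLi.
  have [a _ La] := maximal_generate (maxH i) two_sided_setT nRi nLi
    (rmul e r - r).
  apply: nLi; apply: (subg_transl (sgH i) La).
  have : P i (rmul a e - a).
    rewrite Pi => t; rewrite rmulBl -rmulA -rmulBr; exact: left_idealM.
  by move=> /(_ r); rewrite rmulBl -rmulA -rmulBr.
have allP j : P j = P i0.
  apply: contrapT => nj.
  have [u nHu] := irrH j; have [v nHv] := irrH i0.
  have [i] := covH.2 (v + rmul e (u - v)).
  have [Pi|nPi] := pselect (P i = P i0).
    have -> : v + rmul e (u - v) = u + (rmul e (u - v) - (u - v)).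
      by rewrite opprB addrCA [u + (_ + _)]addrC subrK addrC.
    move=> Hi; apply: (nHu i); first by move=> ij; apply: nj; rewrite -ij.
    have := subgB (sgH i) Hi (PE i (u - v) Pi).
    by rewrite addrK.
  move=> Hi; apply: (nHv i); first by move=> ij; apply: nPi; rewrite ij.
  have Heu : H i (rmul e (u - v)) by apply: (BP i) => //; exact/asboolP.
  by have := subgB (sgH i) Hi Heu; rewrite addrK.
exists e, (H i0).
have idQ : left_ideal [set x | P i0 x /\ forall i, H i x] /\
           right_ideal [set x | P i0 x /\ forall i, H i x].
  have [[P0 PB PM] [_ _ PM']] := tP i0.
  have [D0 DB DM] := bigcap_left_ideal idH.
  split; split=> //.
  - by move=> x y [Px Dx] [Py Dy]; split; [exact: PB|exact: DB].
  - by move=> a x [Px Dx]; split; [exact: PM|exact: DM].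
  - by move=> x y [Px Dx] [Py Dy]; split; [exact: PB|exact: DB].
  - move=> a x [Px Dx]; split=> [|i]; first exact: PM'.
    by have : P i x by rewrite allP.
have Q0 x : P i0 x -> (forall i, H i x) -> x = 0.
  move=> Px Dx; have [idl idr] := idQ; pose Q := Ideal idl idr.
  have : (Q : set R) x by split.
  suff -> : (Q : set R) = [set 0] by [].
  apply: contrapT => nzQ; apply: (noI Q H nzQ covH) => i y [_ Dy]; exact: Dy.
split=> // [r|x Px r].
  apply/eqP; rewrite -subr_eq0; apply/eqP/Q0 => [s|i]; last exact: PE.
  by rewrite rmulBl -rmulA; exact: PE.
apply: Q0 => [|i]; first by have [_ [_ _]] := tP i0; apply.
by have : P i x by rewrite allP.
Qed.
End FiniteRng.

(** * The coefficient field *)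

Section CornerField.
Variables (R : finRngType) (f : R).

Definition corner_pred : {pred R} := fun x => rmul (rmul f x) f == x.

Lemma corner_pred_zmod_closed : zmod_closed corner_pred.
Proof.
split=> [|x y]; rewrite !unfold_in; first by rewrite rmulr0 rmul0r.
by move=> /eqP ex /eqP ey; rewrite /corner_pred rmulBr rmulBl ex ey.
Qed.

HB.instance Definition _ :=
  GRing.isZmodClosed.Build R corner_pred corner_pred_zmod_closed.

Hypotheses (ff : rmul f f = f) (f0 : f != 0).

(** The proofs are parameters because the ring structure depends on them. *)
Definition corner (_ : rmul f f = f) (_ : f != 0) := {x : R | x \in corner_pred}.

Local Notation D := (corner ff f0).
HB.instance Definition _ := Finite.on D.
HB.instance Definition _ := SubType.on D.
HB.instance Definition _ := [SubChoice_isSubZmodule of D by <:].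

Lemma cornerP (x : R) : reflect (rmul (rmul f x) f = x) (x \in corner_pred).
Proof. exact: eqP. Qed.

Lemma corner_idl (x : D) : rmul f (val x) = val x.
Proof. by have /cornerP {1 2}<- := valP x; rewrite !rmulA ff. Qed.

Lemma corner_idr (x : D) : rmul (val x) f = val x.
Proof. by have /cornerP {1 2}<- := valP x; rewrite -!rmulA ff. Qed.

Lemma corner_mul_subproof (x y : D) : rmul (val x) (val y) \in corner_pred.
Proof. by apply/cornerP; rewrite rmulA corner_idl -rmulA corner_idr. Qed.

Lemma corner_one_subproof : f \in corner_pred.
Proof. by apply/cornerP; rewrite !ff. Qed.

Definition corner_mul (x y : D) : D :=
  exist (fun z => z \in corner_pred) _ (corner_mul_subproof x y).
Definition corner_one : D :=
  exist (fun z => z \in corner_pred) _ corner_one_subproof.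

Lemma corner_mulA : associative corner_mul.
Proof. by move=> x y z; apply: val_inj; rewrite /= rmulA. Qed.
Lemma corner_mul1 : left_id corner_one corner_mul.
Proof. by move=> x; apply: val_inj; exact: corner_idl. Qed.
Lemma corner_mulr1 : right_id corner_one corner_mul.
Proof. by move=> x; apply: val_inj; exact: corner_idr. Qed.
Lemma corner_mulDl : left_distributive corner_mul +%R.
Proof. by move=> x y z; apply: val_inj; rewrite /= rmulDl. Qed.
Lemma corner_mulDr : right_distributive corner_mul +%R.
Proof. by move=> x y z; apply: val_inj; rewrite /= rmulDr. Qed.
Lemma corner_one_neq0 : corner_one != 0.
Proof. by apply/eqP => /(congr1 val) /= /eqP; rewrite (negbTE f0). Qed.

HB.instance Definition _ := GRing.Zmodule_isNzRing.Build D corner_mulA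
  corner_mul1 corner_mulr1 corner_mulDl corner_mulDr corner_one_neq0.
HB.instance Definition _ := FinRing.isNzRing.Build D.

Hypothesis divD : forall x : R, rmul (rmul f x) f = x -> x <> 0 ->
  exists2 y, rmul (rmul f y) f = y & rmul y x = f.

Lemma corner_domain : GRing.integral_domain_axiom D.
Proof.
move=> x y /(congr1 val) /= xy0; apply/orP.
have [x0|x0] := eqVneq x 0; first by left; apply/eqP.
right; have [|z _ zx] := divD (x := val x) (elimT (cornerP _) (valP x)).
  by move=> x0'; move/eqP: x0; apply; apply: val_inj.
apply/eqP/val_inj; rewrite /= -[val y]corner_idl -zx -rmulA xy0.
exact: rmulr0.
Qed.

(** The field is handed over together with its embedding, so that what follows
    does not depend on its construction. *)
Lemma corner_finField : exists (F : finFieldType) (iota : F -> R),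
  [/\ {morph iota : a b / a + b >-> a + b},
      {morph iota : a b / a * b >-> rmul a b}, iota 1 = f, injective iota &
      forall x, rmul (rmul f x) f = x <-> exists a, iota a = x].
Proof.
exists (FinDomainFieldType corner_domain), (val : D -> R); split=> //.
move=> x; split=> [fx|[a <-]]; last exact/cornerP/valP.
by have /cornerP px := fx; exists (exist (fun z => z \in corner_pred) x px : D).
Qed.
End CornerField.

Section Primitive.
Variables (R : finRngType) (e : R) (L : set R).
Hypothesis prim : left_primitive e L.

Lemma prim_generate y : ~ L y -> forall x, exists a, L (x - rmul a y).
Proof.
have [he maxL annL] := prim => nLy x.
have [|a _ La] := maximal_generate maxL (@two_sided_setT R) _ nLy x.
  move=> TC; apply: nLy; have [[L0 _ _] _ _] := maxL.
  rewrite -(he y) (annL e) //; exact: TC.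
by exists a.
Qed.

Lemma prim_act x : rmul x e <> 0 -> exists r, ~ L (rmul x r).
Proof.
have [_ _ annL] := prim => xe0; apply: contrapT => nr; apply: xe0.
by apply: annL => r; apply: contrapT => nLr; apply: nr; exists r.
Qed.

Lemma prim_idL : left_ideal L. Proof. by have [_ []] := prim. Qed.
Lemma prim_sgL : subgroup L. Proof. exact/left_ideal_subgroup/prim_idL. Qed.

(** [x e <> 0] expresses that [x] acts nontrivially on [R / L]; the statement
    is the primeness of the annihilator of [R / L], on elements. *)
Lemma prim_prime x y : rmul x e <> 0 -> rmul y e <> 0 ->
  exists s, rmul (rmul x (rmul s y)) e <> 0.
Proof.
move=> /prim_act[r nLr] /prim_act[t nLt].
have [s Ls] := prim_generate nLt r.
exists s => xsy0; apply: nLr.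
have [he _ _] := prim.
apply: (subg_transl prim_sgL (y := rmul x (rmul s (rmul y t)))).
  by rewrite -rmulBr; apply: left_idealM prim_idL _.
have -> : rmul x (rmul s (rmul y t)) = rmul (rmul (rmul x (rmul s y)) e) t.
  by rewrite -!rmulA he.
by rewrite xsy0 rmul0r; exact: subg0 prim_sgL.
Qed.

Lemma idempotent_act f : rmul f f = f -> f <> 0 -> rmul f e <> 0.
Proof.
move=> ff f0 fe0; apply: f0; have [he _ _] := prim.
by have <- : rmul (rmul f e) f = f; [rewrite -rmulA he|rewrite fe0 rmul0r].
Qed.

Lemma corner_act f x : rmul f f = f -> rmul x f = x -> x <> 0 -> rmul x e <> 0.
Proof.
move=> ff xf x0 xe0; apply: x0; have [he _ _] := prim.
by have <- : rmul (rmul x e) f = x; [rewrite -rmulA he|rewrite xe0 rmul0r].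
Qed.

(** Take [f] with [f R] least.  For [x <> 0] in [f R f] some [f t x] fixes a
    nonzero element of [R / L], so an idempotent of this form exists; it
    generates [f R] by the choice of [f], hence equals [f]. *)
Lemma division_corner_exists : exists f : R, [/\ rmul f f = f, f <> 0 &
  forall x : R, rmul (rmul f x) f = x -> x <> 0 ->
    exists2 y, rmul (rmul f y) f = y & rmul y x = f].
Proof.
have [he [[L0 _ _] nL _] _] := prim.
pose P (f : R) := rmul f f = f /\ f <> 0.
have [|f [ff f0] minf] :=
    @exists_min _ P (fun f : R => csize [set x : R | exists r, x = rmul f r]).
  exists e; split=> // e0; apply: nL; rewrite -subTset => x _.
  by rewrite -(he x) e0 rmul0r.
exists f; split=> // x fxf x0.
have xf : rmul x f = x by rewrite -fxf -rmulA ff.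
have fx : rmul f x = x by rewrite -fxf -rmulA rmulA ff rmulA.
have [r nLr] := prim_act (corner_act ff xf x0).
pose v := rmul f r.
have nLxv : ~ L (rmul x v) by rewrite /v rmulA xf.
have nLv : ~ L v by move=> Lv; apply: nLxv; exact: left_idealM prim_idL Lv.
have [s Ls] := prim_generate nLxv v.
pose Q g := (exists t, g = rmul f (rmul t x)) /\ L (v - rmul g v).
have Qg : Q (rmul f (rmul s x)).
  split; first by exists s.
  have -> : v - rmul (rmul f (rmul s x)) v = rmul f (v - rmul s (rmul x v)).
    by rewrite rmulBr -!rmulA; congr (_ - _); rewrite /v rmulA ff.
  exact: left_idealM prim_idL Ls.
have [|g [[t gt] Lg] gg] := semigroup_idempotent Qg.
  move=> _ b [[t ->] La] [[u bu] Lb]; split.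
    by exists (rmul t (rmul x (rmul f u))); rewrite bu -!rmulA.
  apply: (subg_trans prim_sgL (y := rmul (rmul f (rmul t x)) v)) => //.
  by rewrite -[rmul (rmul _ b) v]rmulA -rmulBr; exact: left_idealM prim_idL Lb.
have g0 : g <> 0 by move=> g0; apply: nLv; rewrite g0 rmul0r subr0 in Lg.
have fg : rmul f g = g by rewrite gt rmulA ff.
have gf : rmul g f = g by rewrite gt -!rmulA xf.
have fR : [set x : R | exists r, x = rmul g r] =
          [set x : R | exists r, x = rmul f r].
  apply: csize_eq; last by apply: minf; split.
  by move=> _ [z ->]; exists (rmul g z); rewrite rmulA fg.
have [z fz] : [set x : R | exists r, x = rmul g r] f by rewrite fR; exists f.
have gE : g = f by rewrite -gf [in LHS]fz rmulA gg -fz.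
exists (rmul (rmul f t) f); first by rewrite !rmulA ff -!rmulA ff.
by rewrite -!rmulA fx -gt gE.
Qed.

Section Biorthogonal.
Variables (f : R) (ff : rmul f f = f) (f0 : f <> 0).
Hypothesis divf : forall x, rmul (rmul f x) f = x -> x <> 0 ->
    exists2 y, rmul (rmul f y) f = y & rmul y x = f.

Definition biorthogonal n (u w : 'I_n -> R) :=
  [/\ forall i, rmul (u i) f = u i, forall i, rmul f (w i) = w i &
      forall i j, rmul (w i) (u j) = if i == j then f else 0].

Lemma biorthogonal_le n (u w : 'I_n -> R) : biorthogonal u w -> (n <= #|R|)%N.
Proof.
move=> [_ _ wu]; rewrite -[n in (n <= _)%N]card_ord.
apply: (@leq_card _ _ u) => i j uij.
have := wu i j; rewrite -uij wu eqxx; case: eqP => // _ /f0 [].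
Qed.

(** If [e' = sum_i u_i w_i] is not a left identity, then [e - e'] acts
    nontrivially on [R / L], and primeness gives a pair [u_0], [w_0] of the form
    [(e - e') s f], [y f s' (e - e')], orthogonal to the given ones. *)
Lemma biorthogonal_extend n (u w : 'I_n -> R) : biorthogonal u w ->
  (exists r, \sum_i rmul (u i) (rmul (w i) r) <> r) ->
  exists u' w' : 'I_n.+1 -> R, biorthogonal u' w'.
Proof.
have [he _ _] := prim.
move=> [uf fw wu] [r nr].
pose e' := \sum_i rmul (u i) (w i).
have e'E z : rmul e' z = \sum_i rmul (u i) (rmul (w i) z).
  by rewrite rmul_suml; apply: eq_bigr => i _; rewrite rmulA.
have we' i : rmul (w i) e' = w i.
  rewrite rmul_sumr (bigD1 i) //= rmulA wu eqxx fw big1 ?addr0 // => j ji.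
  by rewrite rmulA wu eq_sym (negbTE ji) rmul0r.
have e'u j : rmul e' (u j) = u j.
  rewrite e'E (bigD1 j) //= wu eqxx uf big1 ?addr0 // => i ij.
  by rewrite wu (negbTE ij) rmulr0.
pose z := e - e'.
have ze : rmul z e <> 0.
  move=> ze0; apply: nr; rewrite -e'E -[in LHS](he r) rmulA.
  by move/eqP: ze0; rewrite /z rmulBl subr_eq0 he => /eqP <-.
have fe := idempotent_act ff f0.
have [s zsf] := prim_prime ze fe.
have [u0 u0E] : exists u0, u0 = rmul (rmul z s) f by exists (rmul (rmul z s) f).
have u0f : rmul u0 f = u0 by rewrite u0E -rmulA ff.
have u0N : u0 <> 0 by move=> u00; apply: zsf; rewrite rmulA -u0E u00 rmul0r.
have wu0 i : rmul (w i) u0 = 0.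
  by rewrite u0E /z !rmulA rmulBr we' rmulBl -rmulA he subrr rmul0r.
have e'u0 : rmul e' u0 = 0 by rewrite e'E big1 // => i _; rewrite wu0 rmulr0.
have [s' fsu] := prim_prime fe (corner_act ff u0f u0N).
have [d dE] : exists d, d = rmul f (rmul s' u0) by exists (rmul f (rmul s' u0)).
have fdf : rmul (rmul f d) f = d by rewrite dE rmulA ff -!rmulA u0f.
have d0 : d <> 0 by move=> d0; apply: fsu; rewrite -dE d0 rmul0r.
have [y fyf yd] := divf fdf d0.
pose w0 := rmul (rmul y (rmul f s')) (e - e').
have w0u0 : rmul w0 u0 = f.
  by rewrite /w0 -rmulA rmulBl e'u0 subr0 he -[RHS]yd dE !rmulA.
have w0u j : rmul w0 (u j) = 0.
  by rewrite /w0 -rmulA rmulBl e'u he subrr rmulr0.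
have fw0 : rmul f w0 = w0.
  by rewrite /w0 !rmulA -fyf !rmulA ff.
pose ext (x : R) (t : 'I_n -> R) i := if unlift ord0 i is Some j then t j else x.
exists (ext u0 u), (ext w0 w); split=> [i|i|i j]; rewrite /ext.
- by case: unliftP.
- by case: unliftP.
- case: (unliftP ord0 i) => [i' ->|->]; case: (unliftP ord0 j) => [j' ->|->].
  + by rewrite wu (inj_eq lift_inj).
  + by rewrite wu0 eq_sym (negbTE (neq_lift _ _)).
  + by rewrite w0u (negbTE (neq_lift _ _)).
  + by rewrite w0u0 eqxx.
Qed.

Lemma biorthogonal_complete : exists n (u w : 'I_n -> R), biorthogonal u w /\
  forall r, \sum_i rmul (u i) (rmul (w i) r) = r.
Proof.
pose P n := exists u w : 'I_n -> R, biorthogonal u w.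
have [||n [u [w uw]] maxn] := @exists_max _ P id #|R|.
- by exists 0, (fun=> 0), (fun=> 0); split=> -[].
- by move=> n [u [w uw]]; exact: biorthogonal_le uw.
exists n, u, w; split=> // r; apply: contrapT => nr.
have [|u' [w' uw']] := biorthogonal_extend uw; first by exists r.
by have := maxn n.+1; rewrite ltnn => /(_ (ex_intro _ u' (ex_intro _ w' uw'))).
Qed.
End Biorthogonal.
End Primitive.

(** * Coordinates *)

(** [R] is isomorphic to a Munn ring: [n] by [n + m] matrices with product
    [X S Y], where the sandwich matrix [S] is the identity above zero rows. *)
Definition sandwich (R : rngType) (F : fieldType) n m
    (g : 'M[F]_(n, n + m) -> R) :=
  [/\ bijective g, {morph g : X Y / X + Y >-> X + Y} &
      forall X Y, g (lsubmx X *m Y) = rmul (g X) (g Y)].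

Section Coordinates.
Variables (R : finRngType) (f : R) (F : finFieldType) (iota : F -> R).
Hypotheses (iotaD : {morph iota : a b / a + b >-> a + b})
  (iotaM : {morph iota : a b / a * b >-> rmul a b}) (iota1 : iota 1 = f)
  (iota_inj : injective iota)
  (iota_im : forall x, rmul (rmul f x) f = x <-> exists a, iota a = x).

Lemma iota0 : iota 0 = 0.
Proof. by apply: (addrI (iota 0)); rewrite -iotaD !addr0. Qed.

Lemma iotaN a : iota (- a) = - iota a.
Proof. by apply/eqP; rewrite -addr_eq0 -iotaD addNr iota0. Qed.

Lemma iota_sum (I : finType) (G : I -> F) :
  iota (\sum_i G i) = \sum_i iota (G i).
Proof. exact: (big_morph iota iotaD iota0). Qed.

Lemma mul_f_iota a : rmul f (iota a) = iota a.
Proof. by rewrite -iota1 -iotaM mul1r. Qed.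

Definition comb n (b : 'I_n -> R) (c : 'I_n -> F) : R :=
  \sum_k rmul (iota (c k)) (b k).

Lemma comb_mulr n (b : 'I_n -> R) c x :
  rmul (comb b c) x = \sum_k rmul (iota (c k)) (rmul (b k) x).
Proof. by rewrite rmul_suml; apply: eq_bigr => k _; rewrite rmulA. Qed.

Lemma mul_f_comb n (b : 'I_n -> R) c : rmul f (comb b c) = comb b c.
Proof. by rewrite rmul_sumr; apply: eq_bigr => k _; rewrite rmulA mul_f_iota. Qed.

Lemma combB n (b : 'I_n -> R) c d :
  comb b (fun k => c k - d k) = comb b c - comb b d.
Proof.
rewrite -sumrB; apply: eq_bigr => k _.
by rewrite iotaD iotaN rmulBl.
Qed.

Definition free n (b : 'I_n -> R) := forall c, comb b c = 0 -> forall k, c k = 0.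

Lemma free_le n (b : 'I_n -> R) : free b -> (n <= #|R|)%N.
Proof.
move=> fb; pose h (c : {ffun 'I_n -> F}) := comb b c.
have /leq_card : injective h.
  move=> c d cd; apply/ffunP => k; apply/eqP; rewrite -subr_eq0; apply/eqP.
  by apply: (fb (fun k => c k - d k)); rewrite combB -/(h c) cd subrr.
rewrite card_ffun card_ord; apply: leq_trans.
have q1 : (1 < #|F|)%N := card_finNzRing_gt1 F.
by apply: ltnW; exact: ltn_expl.
Qed.

Lemma finite_basis (Z : set R) :
  (forall v, Z v -> rmul f v = v) ->
  exists m (b : 'I_m -> R), [/\ forall k, Z (b k), free b &
    forall v, Z v -> exists c, v = comb b c].
Proof.
move=> fZ; pose P m := exists2 b : 'I_m -> R, (forall k, Z (b k)) & free b.
(* A free family of largest length spans: a vector outside its span could be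
   added to it. *)
have [||m [b Zb fb] maxm] := @exists_max _ P id #|R|.
- by exists 0%N, (fun=> 0) => [[]//|c _ []].
- by move=> m [b _ fb]; exact: free_le fb.
exists m, b; split=> // v Zv; apply: contrapT => nv.
pose b' (i : 'I_m.+1) := if unlift ord0 i is Some j then b j else v.
suff /maxm : P m.+1 by rewrite /= ltnn.
exists b'.
  by move=> i; rewrite /b'; case: unliftP => [j _|_].
move=> c; rewrite /comb big_ord_recl /b' unlift_none.
under eq_bigr do rewrite liftK.
rewrite -/(comb b (fun k => c (lift ord0 k))).
have [c0|c0] := eqVneq (c ord0) 0.
  rewrite c0 iota0 rmul0r add0r => /fb cl i.
  by case: (unliftP ord0 i) => [j ->|->].
move=> e; exfalso; apply: nv.
exists (fun k => - ((c ord0)^-1 * c (lift ord0 k))).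
have e' : rmul (iota (c ord0)) v = - comb b (fun k => c (lift ord0 k)).
  by apply/eqP; rewrite -addr_eq0 e.
rewrite -(fZ v Zv) -iota1 -(mulVf c0) iotaM -rmulA e' rmulNr rmul_sumr.
rewrite -sumrN; apply: eq_bigr => k _.
by rewrite iotaN iotaM rmulNl rmulA.
Qed.

Variables (n : nat) (u w : 'I_n -> R).
Hypotheses (uw : biorthogonal f u w)
  (complete : forall r, \sum_i rmul (u i) (rmul (w i) r) = r).

(** The rows of the matrix of [r] are the coordinates of the [w_i r] in the left
    [F]-space [f R], in a basis made of the [w_j] and of a basis of the
    subspace [Z] of the elements that annihilate [R] from the left.  The product
    comes out because [w_j u_i = delta_ij f] and [Z R = 0]. *)
Lemma sandwich_of_biorthogonal : exists m (g : 'M[F]_(n, n + m) -> R),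
  sandwich g.
Proof.
have [uf fw wu] := uw.
pose Z (p : R) := rmul f p = p /\ forall r, rmul p r = 0.
have [|m [p [Zp fp spanp]]] := @finite_basis Z; first by move=> v [].
pose b k := match fintype.split k with inl j => w j | inr k => p k end.
have bl j : b (lshift m j) = w j by rewrite /b -[lshift m j]/(unsplit (inl j)) unsplitK.
have br k : b (rshift n k) = p k by rewrite /b -[rshift n k]/(unsplit (inr k)) unsplitK.
have combE c : comb b c =
    comb w (fun j => c (lshift m j)) + comb p (fun k => c (rshift n k)).
  rewrite /comb big_split_ord /=; congr (_ + _); apply: eq_bigr => k _.
    by rewrite bl.
  by rewrite br.
have pr k r : rmul (p k) r = 0 by case: (Zp k).
have comb_p_mul c r : rmul (comb p c) r = 0.
  by rewrite comb_mulr big1 // => k _; rewrite pr rmulr0.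
have comb_w_u c j : rmul (comb w c) (u j) = iota (c j).
  rewrite comb_mulr (bigD1 j) //= wu eqxx big1 => [|i ij].
    by rewrite addr0 -iota1 -iotaM mulr1.
  by rewrite wu (negbTE ij) rmulr0.
have freeb : free b.
  move=> c cb0.
  have cl j : c (lshift m j) = 0.
    apply: iota_inj; rewrite iota0 -(comb_w_u (fun j => c (lshift m j))).
    rewrite -[LHS]addr0 -(comb_p_mul (fun k => c (rshift n k)) (u j)).
    by rewrite -rmulDl -combE cb0 rmul0r.
  have cr : comb p (fun k => c (rshift n k)) = 0.
    rewrite -[LHS]add0r -[RHS]cb0 combE; congr (_ + _).
    by rewrite /comb big1 // => j _; rewrite cl iota0 rmul0r.
  move=> k; rewrite -(splitK k).
  by case: (fintype.split k) => j; [exact: cl|exact: fp cr j].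
have spanb x : rmul f x = x -> exists c, x = comb b c.
  move=> fx.
  have dex j : exists a, iota a = rmul x (u j).
    by apply/iota_im; rewrite rmulA fx -rmulA uf.
  have [d dP] := choice dex.
  have [|c' Dc'] := spanp (x - comb w d).
    split=> [|r]; first by rewrite rmulBr mul_f_comb fx.
    rewrite -(complete r) rmul_sumr big1 // => j _.
    by rewrite rmulA rmulBl comb_w_u dP subrr rmul0r.
  pose c k := match fintype.split k with inl j => d j | inr k => c' k end.
  exists c; rewrite combE -[LHS](subrK (comb w d)) addrC Dc'; congr (_ + _).
    by apply: eq_bigr => j _; rewrite /c -[lshift m j]/(unsplit (inl j)) unsplitK.
  by apply: eq_bigr => j _; rewrite /c -[rshift n j]/(unsplit (inr j)) unsplitK.
pose g (X : 'M[F]_(n, n + m)) := \sum_i rmul (u i) (comb b (X i)).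
have wg i X : rmul (w i) (g X) = comb b (X i).
  rewrite rmul_sumr (bigD1 i) //= rmulA wu eqxx mul_f_comb big1 ?addr0 // => j ji.
  by rewrite rmulA wu eq_sym (negbTE ji) rmul0r.
have g_inj : injective g.
  move=> X Y gXY; apply/matrixP => i k; apply/eqP; rewrite -subr_eq0; apply/eqP.
  by apply: (freeb (fun k => X i k - Y i k)); rewrite combB -!wg gXY subrr.
have g_surj r : exists X, g X = r.
  have cex i : exists c, rmul (w i) r = comb b c.
    by apply: spanb; rewrite rmulA fw.
  have [c cP] := choice cex.
  exists (\matrix_(i, k) c i k); rewrite -[RHS]complete.
  apply: eq_bigr => i _; rewrite cP; congr rmul.
  by apply: eq_bigr => k _; rewrite mxE.
exists m, g; split.
- have [h hP] := choice g_surj; exists h => // X.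
  by apply: g_inj; rewrite hP.
- move=> X Y; rewrite -big_split /=; apply: eq_bigr => i _.
  rewrite -rmulDr; congr rmul; rewrite -big_split /=; apply: eq_bigr => k _.
  by rewrite mxE iotaD rmulDl.
- move=> X Y; rewrite rmul_suml; apply: eq_bigr => i _.
  rewrite -rmulA; congr rmul.
  rewrite [comb b (X i)]combE rmulDl comb_p_mul addr0 comb_mulr.
  under [RHS]eq_bigr do rewrite wg rmul_sumr.
  rewrite exchange_big /=; apply: eq_bigr => k _.
  rewrite !mxE iota_sum rmul_suml; apply: eq_bigr => j _.
  by rewrite !mxE iotaM rmulA.
Qed.
End Coordinates.

Lemma primitive_sandwich (R : finRngType) (e : R) L : left_primitive e L ->
  exists (F : finFieldType) n m (g : 'M[F]_(n, n + m) -> R), sandwich g.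
Proof.
move=> prim; have [f [ff f0 divf]] := division_corner_exists prim.
have [n [u [w [uw complete]]]] := biorthogonal_complete prim ff f0 divf.
have [|F [iota [iD iM i1 iI iim]]] := corner_finField ff _ divf.
  exact/eqP.
exists F, n; exact: sandwich_of_biorthogonal iD iM i1 iI iim _ _ _ uw complete.
Qed.

Lemma tight_sandwich (R : rngType) k : noncommutative R ->
  tight left_ideal R k ->
  exists (F : finFieldType) n m (g : 'M[F]_(n, n + m) -> R), sandwich g.
Proof.
move=> ncR tR; have [R' R'E] := finite_rng_finRngType (tight_finite tR).
rewrite -R'E in ncR tR *.
have [e [L prim]] := tight_primitive tR ncR.
exact: primitive_sandwich prim.
Qed.

(** * Left ideals as spaces of rows *)

Section KernelVectors.
Variable F : fieldType.

Lemma kernel_vector p q (A : 'M[F]_(p, q)) : ~~ row_full A ->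
  exists2 c : 'cV[F]_q, c != 0 & A *m c = 0.
Proof.
rewrite -cokermx_eq0 => /matrix0Pn[i [j nz]].
exists (col j (cokermx A)); first by apply/matrix0Pn; exists i, 0; rewrite mxE.
by rewrite colE mulmxA mulmx_coker mul0mx.
Qed.

Lemma wide_kernel_vector p q (A : 'M[F]_(p, q)) : (p < q)%N ->
  exists2 c : 'cV[F]_q, c != 0 & A *m c = 0.
Proof.
move=> pq; apply: kernel_vector; rewrite /row_full neq_ltn.
by rewrite (leq_ltn_trans (rank_leq_row A)).
Qed.

(** The matrix is the projection along [c] onto the hyperplane [z_k = 0], where
    [c_k <> 0], with its zero row [k] deleted. *)
Lemma line_kernel_matrix d N (c : 'cV[F]_N) : N = d.+1 -> c != 0 ->
  exists T : 'M[F]_(d, N), [/\ T *m c = 0,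
    forall z, T *m z = 0 -> exists a, z = a *: c &
    forall p (Y : 'M[F]_(p, N)), Y *m c = 0 -> exists A, Y = A *m T].
Proof.
move=> eN; move: c; rewrite {N}eN => c /matrix0Pn[k [j]]; rewrite (ord1 j) => ck.
pose M : 'M[F]_d.+1 := 1%:M - (c k 0)^-1 *: (c *m delta_mx 0 k).
have Mz z : M *m z = z - ((c k 0)^-1 * z k 0) *: c.
  rewrite mulmxBl mul1mx -scalemxAl -mulmxA -rowE.
  by rewrite [row k z]mx11_scalar mul_mx_scalar mxE scalerA.
have Mk l : M k l = 0.
  by rewrite !mxE big_ord1 !mxE eqxx /= mulrA mulVf // mul1r eq_sym subrr.
have Tz z : row' k M *m z = row' k (M *m z).
  by apply/matrixP => i l; rewrite !mxE; apply: eq_bigr => h _; rewrite mxE.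
exists (row' k M); split=> [|z|p Y Yc].
- rewrite Tz Mz mulVf // scale1r subrr.
  by apply/matrixP => i l; rewrite !mxE.
- rewrite Tz => zK; exists ((c k 0)^-1 * z k 0).
  apply/eqP; rewrite -subr_eq0 -Mz; apply/eqP/matrixP => i l.
  case: (unliftP k i) => [h ->|->]; first by move/matrixP/(_ h l): zK; rewrite !mxE.
  by rewrite !mxE big1 // => h _; rewrite Mk mul0r.
- exists (col' k Y); have YM : Y *m M = Y.
    by rewrite mulmxBr mulmx1 -scalemxAr mulmxA Yc mul0mx scaler0 subr0.
  apply/matrixP => i l; have /matrixP/(_ i l) <- := YM.
  rewrite [LHS]mxE (bigD1_ord k) //= Mk mulr0 add0r.
  rewrite [RHS]mxE; apply: eq_bigr => h _.
  by rewrite !mxE.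
Qed.
End KernelVectors.

Section Sandwich.
Variables (R : rngType) (F : finFieldType) (n m : nat).
Variables (g : 'M[F]_(n, n + m) -> R) (sg : sandwich g).

Lemma sandwich_inj : injective g.
Proof. by have [/bij_inj] := sg. Qed.

Lemma sandwich_surj r : exists X, g X = r.
Proof. by have [[h _ hK] _ _] := sg; exists (h r). Qed.

Lemma sandwichD X Y : g (X + Y) = g X + g Y. Proof. by have [_] := sg. Qed.

Lemma sandwich0 : g 0 = 0.
Proof. by apply: (addrI (g 0)); rewrite -sandwichD !addr0. Qed.

Lemma sandwichB X Y : g (X - Y) = g X - g Y.
Proof. by apply/eqP; rewrite eq_sym subr_eq -sandwichD subrK. Qed.

Lemma sandwichM X Y : rmul (g X) (g Y) = g (lsubmx X *m Y).
Proof. by have [_ _ ->] := sg. Qed.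

Lemma sandwich_mull (A : 'M[F]_n) Y : rmul (g (row_mx A 0)) (g Y) = g (A *m Y).
Proof. by rewrite sandwichM row_mxKl. Qed.

Definition annihilator (c : 'cV[F]_(n + m)) : set R := g @` [set X | X *m c = 0].

Lemma annihilatorP c X : annihilator c (g X) <-> X *m c = 0.
Proof.
split=> [[Y Yc /sandwich_inj <-]//|Xc].
by exists X.
Qed.

Lemma annihilator_left c : left_ideal (annihilator c).
Proof.
split=> [|_ _ [X Xc <-] [Y Yc <-]|a _ [Y Yc <-]].
- by exists 0; rewrite /= ?mul0mx ?sandwich0.
- by exists (X - Y); rewrite /= ?mulmxBl ?Xc ?Yc ?subrr ?sandwichB.
- have [X <-] := sandwich_surj a.
  by exists (lsubmx X *m Y); rewrite /= -?mulmxA ?Yc ?mulmx0 ?sandwichM.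
Qed.

Lemma annihilator_proper c : (0 < n)%N -> c != 0 -> annihilator c <> [set: R].
Proof.
move=> n0 /matrix0Pn[k [j]]; rewrite (ord1 j) => ck0 e.
have : annihilator c (g (\matrix_(_, l) (l == k)%:R)) by rewrite e.
move=> /annihilatorP/matrixP/(_ (Ordinal n0) 0)/eqP.
rewrite !mxE (bigD1 k) //= mxE eqxx mul1r big1 ?addr0 ?(negbTE ck0) // => l lk.
by rewrite mxE (negbTE lk) mul0r.
Qed.

Lemma annihilatorZ a c : a != 0 -> annihilator (a *: c) = annihilator c.
Proof.
move=> a0; rewrite /annihilator; congr (_ @` _); apply/seteqP; split=> X /=.
  by rewrite -scalemxAr => /eqP; rewrite scaler_eq0 (negbTE a0) => /eqP.
by rewrite -scalemxAr => ->; rewrite scaler0.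
Qed.

(** Every matrix whose rows are in the span of the rows of the elements of [L]
    is in [L], because left multiplication realizes all square matrices. *)
Lemma left_ideal_sub_annihilator (L : set R) : left_ideal L ->
  L <> [set: R] -> exists2 c, c != 0 & L `<=` annihilator c.
Proof.
move=> [L0 LB LM] nL; have sgL : subgroup L by split.
pose M := (\sum_(X : 'M[F]_(n, n + m) | g X \in L) <<X>>)%MS.
have [fullM|nfull] := boolP (row_full M).
  exfalso; apply: nL; rewrite -subTset => r _; have [Y <-] := sandwich_surj r.
  have /sub_sumsmxP[u ->] : (Y <= M)%MS by exact: submx_full.
  have gS : g (\sum_(X : 'M[F]_(n, n + m) | g X \in L) u X *m <<X>>%MS) =
      \sum_(X : 'M[F]_(n, n + m) | g X \in L) g (u X *m <<X>>%MS).
    exact: (big_morph g sandwichD sandwich0).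
  rewrite gS; elim/big_ind: _ => // [x y|X].
    exact: (subgD sgL).
  rewrite inE => LX.
  have /submxP[D ->] : (<<X>> <= X)%MS by rewrite genmxE.
  by rewrite mulmxA -sandwich_mull; exact: LM.
have [c c0 Mc] := kernel_vector nfull; exists c => // r Lr.
have [X gX] := sandwich_surj r; rewrite -gX in Lr *; apply/annihilatorP.
have /submxP[D ->] : (X <= M)%MS.
  rewrite -(genmxE X); apply: (sumsmx_sup X) => //; exact/mem_set.
by rewrite -mulmxA Mc mulmx0.
Qed.
End Sandwich.

(** The members of the cover are contained in the ideals attached to vectors
    [c i] such that every [n] by [n + m] matrix kills one of the [c i].  Take a
    matrix [Q] with the least number [d] of rows killing none of the [c i].
    Then [n < d], and every line of [F^d] contains some [Q (c i)], since
    otherwise projecting along that line would lower [d].  Restricting to a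
    subspace [F^(n+1)] of [F^d] gives a family of vectors on all lines of
    [F^(n+1)], that is a cover of the quotient by the ideal of the matrices whose
    first [n + 1] columns vanish.  This ideal is nonzero if [m > 1]. *)
Lemma tight_sandwich_width (R : rngType) (F : finFieldType) n m k
    (g : 'M[F]_(n, n + m) -> R) :
  sandwich g -> (0 < n)%N -> tight left_ideal R k -> m = 1%N.
Proof.
move=> sg n0 [[H [idH covH]] _ noI].
have cex i : exists c : 'cV[F]_(n + m), c != 0 /\ H i `<=` annihilator g c.
  have [JH nH] := idH i.
  by have [c c0 Hc] := left_ideal_sub_annihilator sg JH nH; exists c.
have [c cP] := choice cex.
have c0 i : c i != 0 by case: (cP i).
have covX (X : 'M_(n, n + m)) : exists i, X *m c i = 0.
  have [i Hi] := covH (g X); exists i; have [_ Hc] := cP i.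
  by apply/(annihilatorP sg); exact: Hc.
have m0 : (0 < m)%N.
  rewrite lt0n; apply/eqP => m0; subst m.
  have [i] := covX (row_mx 1%:M 0).
  rewrite -[c i]vsubmxK mul_row_col mul1mx mul0mx addr0 => ci0.
  by have := c0 i; rewrite -[c i]vsubmxK ci0 [dsubmx _]flatmx0 col_mx0 eqxx.
apply: contrapT => m1; have {m0 m1}m2 : (1 < m)%N.
  by case: (m) m0 m1 => [|[|]].
have nN : (n.+1 <= n + m)%N by rewrite -addn1 leq_add2l ltnW.
pose P d := exists Q : 'M[F]_(d, n + m), forall i, Q *m c i != 0.
have [|d [Q Qc] mind] := @exists_min _ P id.
  by exists (n + m)%N, 1%:M => i; rewrite mul1mx.
have nd : (n < d)%N.
  rewrite ltnNge; apply/negP => dn.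
  have idd : (pid_mx d : 'M[F]_(d, n)) *m (pid_mx d : 'M[F]_(n, d)) = 1%:M.
    by rewrite mul_pid_mx minnn (minn_idPr dn) pid_mx_1.
  have [i] := covX (pid_mx d *m Q); rewrite -mulmxA => ci.
  by have := Qc i; rewrite -[Q *m _]mul1mx -idd -mulmxA ci mulmx0 eqxx.
have Qline (y : 'cV[F]_d) : y != 0 -> exists i a, a != 0 /\ y = a *: (Q *m c i).
  move=> y0.
  have d1 : d = d.-1.+1 by rewrite prednK // (leq_ltn_trans _ nd).
  have [T [_ Tz _]] := line_kernel_matrix d1 y0.
  have : ~ P d.-1 by move=> /mind; rewrite leqNgt -d1 leqnn.
  move=> nP; have [i] : exists i, T *m Q *m c i = 0.
    apply: contrapT => ni; apply: nP; exists (T *m Q) => i.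
    by apply/eqP => ei; apply: ni; exists i.
  rewrite -mulmxA => /Tz[a Qa].
  have a0 : a != 0.
    by apply/eqP => a0; have := Qc i; rewrite Qa a0 scale0r eqxx.
  by exists i, a^-1; rewrite invr_eq0 Qa scalerA mulVf // scale1r.
pose E : 'M[F]_(n + m, n.+1) := pid_mx n.+1.
pose S : 'M[F]_(n.+1, d) := pid_mx n.+1.
pose S' : 'M[F]_(d, n.+1) := pid_mx n.+1.
have SS' : S *m S' = 1%:M by rewrite mul_pid_mx !minnn (minn_idPr nd) pid_mx_1.
pose E' : 'M[F]_(n.+1, n + m) := pid_mx n.+1.
have EE' : E' *m E = 1%:M by rewrite mul_pid_mx !minnn (minn_idPr nN) pid_mx_1.
pose y i := S *m (Q *m c i).
(* The default value only serves to keep a family of [k] proper ideals. *)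
pose z i : 'cV[F]_n.+1 := if y i == 0 then delta_mx 0 0 else y i.
have z0 i : z i != 0.
  rewrite /z; case: ifPn => // _; apply/matrix0Pn; exists 0, 0.
  by rewrite mxE !eqxx oner_eq0.
have Ez0 i : E *m z i != 0.
  by apply/eqP => Ez; have := z0 i; rewrite -[z i]mul1mx -EE' -mulmxA Ez mulmx0 eqxx.
have idI : left_ideal (g @` [set X | X *m E = 0]) /\
           right_ideal (g @` [set X | X *m E = 0]).
  have sgI : subgroup (g @` [set X | X *m E = 0]).
    split; first by exists 0; rewrite /= ?mul0mx ?(sandwich0 sg).
    move=> _ _ [X Xc <-] [Y Yc <-].
    by exists (X - Y); rewrite /= ?mulmxBl ?Xc ?Yc ?subrr ?(sandwichB sg).
  split; case: (sgI) => I0 IB; split=> //.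
    move=> a _ [Y Yc <-]; have [X <-] := sandwich_surj sg a.
    by exists (lsubmx X *m Y); rewrite /= -?mulmxA ?Yc ?mulmx0 ?(sandwichM sg).
  move=> a _ [Y /= Yc <-]; have [X <-] := sandwich_surj sg a.
  exists (lsubmx Y *m X); rewrite ?(sandwichM sg) //=.
  suff -> : lsubmx Y = 0 by rewrite !mul0mx.
  have -> : lsubmx Y = Y *m E *m (pid_mx n : 'M_(n.+1, n)).
    rewrite -mulmxA mul_pid_mx !(minn_idPr (leqnSn n)) pid_mx_col.
    by rewrite -{2}[Y]hsubmxK mul_row_col mulmx1 mulmx0 addr0.
  by rewrite Yc mul0mx.
have [idl idr] := idI.
apply: (noI (Ideal idl idr) (fun i => annihilator g (E *m z i))).
- have lastP : (n + m.-1 < n + m)%N by rewrite ltn_add2l prednK // ltnW.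
  pose X : 'M[F]_(n, n + m) := delta_mx (Ordinal n0) (Ordinal lastP).
  rewrite /nonzero_ideal => e.
  have : (Ideal idl idr : set R) (g X).
    exists X => //=; apply/matrixP => i j.
    rewrite !mxE big1 // => l _; rewrite !mxE.
    have [->|_] := eqVneq l (Ordinal lastP); last by rewrite andbF mul0r.
    have lastN : (n + m.-1 < n.+1)%N = false.
      by apply/negbTE; rewrite -leqNgt -addn1 leq_add2l -ltnS prednK // ltnW.
    by rewrite /= lastN andbF mulr0.
  rewrite e -(sandwich0 sg) => /(sandwich_inj sg)/matrixP.
  by move=> /(_ (Ordinal n0) (Ordinal lastP))/eqP; rewrite !mxE !eqxx oner_eq0.
- split=> [i|r].
    by split; [exact: annihilator_left|exact: annihilator_proper].
  have [X <-] := sandwich_surj sg r.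
  have [v v0 Xv] := wide_kernel_vector (X *m E) (ltnSn n).
  have [|i [a [a0 Sv]]] := Qline (S' *m v).
    apply/eqP => Sv; have := v0; rewrite -[v]mul1mx -SS' -mulmxA Sv mulmx0.
    by rewrite eqxx.
  have vE : v = a *: y i by rewrite -[v]mul1mx -SS' -mulmxA Sv -scalemxAr.
  exists i; apply/(annihilatorP sg).
  have y0 : y i != 0 by apply/eqP => y0; move: v0; rewrite vE y0 scaler0 eqxx.
  rewrite /z (negbTE y0) mulmxA; apply/eqP; move/eqP: Xv.
  by rewrite vE -scalemxAr scaler_eq0 (negbTE a0).
- move=> i _ [X /= XE <-]; apply/(annihilatorP sg).
  by rewrite mulmxA XE mul0mx.
Qed.

(** * The minimal cover of the matrix ring *)

Section Points.
Variables (F : finFieldType) (N : nat).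
Implicit Types c : 'cV[F]_N.

(** Scaling the first nonzero coordinate to [1] selects one vector on each
    line. *)
Definition normalize c : 'cV[F]_N :=
  if [pick k | c k 0 != 0] is Some k then (c k 0)^-1 *: c else c.

Lemma normalizeZ a c : a != 0 -> normalize (a *: c) = normalize c.
Proof.
move=> a0; rewrite /normalize.
rewrite (@eq_pick _ _ (fun k => c k 0 != 0)) => [|k]; last first.
  by rewrite /= mxE mulf_eq0 (negbTE a0).
case: pickP => [k ck|c0].
  by rewrite mxE scalerA invfM mulrAC mulVf // mul1r.
suff -> : c = 0 by rewrite scaler0.
apply/matrixP => k j; rewrite (ord1 j) mxE.
by apply/eqP; have := c0 k; case: eqP.
Qed.

Lemma normalize_eq c : c != 0 ->
  exists2 a, a != 0 & normalize c = a *: c.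
Proof.
move=> /matrix0Pn[k [j]]; rewrite (ord1 j) /normalize => ck.
case: pickP => [l cl|/(_ k)]; last by rewrite ck.
by exists (c l 0)^-1; rewrite ?invr_eq0.
Qed.

Definition points : {set 'cV[F]_N} := [set c | (c != 0) && (normalize c == c)].

Lemma normalize_points c : c != 0 -> normalize c \in points.
Proof.
move=> c0; have [a a0 nc] := normalize_eq c0; rewrite inE nc.
by rewrite normalizeZ // nc eqxx scaler_eq0 negb_or a0 c0.
Qed.

Lemma points_inj c c' a : c \in points -> c' \in points -> a != 0 ->
  c' = a *: c -> c' = c.
Proof.
rewrite !inE => /andP[_ /eqP nc] /andP[_ /eqP nc'] a0 e.
by rewrite -nc' e normalizeZ.
Qed.

(** A nonzero vector is a normalized one times a nonzero scalar, uniquely. *)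
Lemma card_points : (#|points| * (#|F| - 1) = #|F| ^ N - 1)%N.
Proof.
pose U : {set F} := [set a | a != 0]%SET.
have cU : #|U| = (#|F| - 1)%N.
  by rewrite subn1 -(cardC1 0) cardsE; apply: eq_card => a; rewrite !inE.
pose h (p : 'cV[F]_N * F) := p.2 *: p.1.
have hE : h @: finset.setX points U = [set c : 'cV[F]_N | c != 0]%SET.
  apply/setP => c; rewrite !inE; apply/imsetP/idP.
    move=> [[x a]]; rewrite !inE /= => /andP[/andP[x0 _] a0] ->.
    by rewrite scaler_eq0 negb_or a0.
  move=> c0; have [a a0 nc] := normalize_eq c0.
  exists (normalize c, a^-1).
    by rewrite finset.in_setX normalize_points //= inE invr_eq0.
  by rewrite /h /= nc scalerA mulVf // scale1r.
have h_inj : {in finset.setX points U &, injective h}.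
  move=> [x a] [y b]; rewrite !finset.in_setX /h /= => /andP[xP] + /andP[yP].
  rewrite !inE => a0 b0 e.
  have yx : y = x.
    apply: (points_inj (a := b^-1 * a)) => //.
      by rewrite mulf_neq0 ?invr_eq0.
    by rewrite -scalerA e scalerA mulVf // scale1r.
  rewrite yx in e *; congr (_, _).
  have : (a - b) *: x == 0 by rewrite scalerBl e subrr.
  move: xP; rewrite inE => /andP[x0 _].
  by rewrite scaler_eq0 (negbTE x0) orbF subr_eq0 => /eqP.
rewrite -cU -finset.cardsX -(card_in_imset h_inj) hE.
rewrite subn1 -[X in (_ ^ X)%N]muln1 -card_mx -(cardC1 0) cardsE.
by apply: eq_card => c; rewrite !inE.
Qed.
End Points.

Section ColumnExtension.
Variables (R : rngType) (F : finFieldType) (n : nat).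
Variables (g : 'M[F]_(n, n + 1) -> R) (sg : sandwich g).
Hypothesis n0 : (0 < n)%N.

Definition hyperplanes : set (set R) :=
  annihilator g @` [set c | c != 0].

(** The ideal of [c] is the left ideal generated by a matrix [T] with kernel
    spanned by [c], and it is the only proper left ideal that contains [T]. *)
Lemma sub_annihilator_eq (L : set R) (c : 'cV[F]_(n + 1)) T :
  left_ideal L -> L <> [set: R] ->
  (forall z, T *m z = 0 -> exists a, z = a *: c) ->
  (forall p (Y : 'M[F]_(p, n + 1)), Y *m c = 0 -> exists A, Y = A *m T) ->
  L (g T) -> L = annihilator g c.
Proof.
move=> idL nL Tz YT LT.
have [c' c'0 Lc'] := left_ideal_sub_annihilator sg idL nL.
have /Lc'/(annihilatorP sg)/Tz[a c'E] := LT.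
have a0 : a != 0 by apply/eqP => a0; move: c'0; rewrite c'E a0 scale0r eqxx.
apply/seteqP; split; first by rewrite -(annihilatorZ g c a0) -c'E.
move=> _ [Y /= /YT[A ->] <-]; rewrite -(sandwich_mull sg).
exact: left_idealM idL LT.
Qed.

Lemma hyperplanes_min_cover : min_cover left_ideal hyperplanes.
Proof.
split=> [|D [JD cD]].
  split=> [_ [c c0 <-]|].
    by split; [exact: annihilator_left|exact: annihilator_proper].
  rewrite -subTset => r _; have [X <-] := sandwich_surj sg r.
  have [c c0 Xc] : exists2 c : 'cV[F]_(n + 1), c != 0 & X *m c = 0.
    by apply: wide_kernel_vector; rewrite addn1.
  by exists (annihilator g c); [exists c|exact/(annihilatorP sg)].
apply: subset_card_le => _ [c c0 <-].
have [T [_ Tz YT]] := line_kernel_matrix (addn1 n) c0.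
have : [set: R] (g T) by [].
rewrite -cD => -[L DL LT]; have [idL nL] := JD L DL.
by rewrite -(sub_annihilator_eq idL nL Tz YT LT).
Qed.

Lemma mulmx_transitive (x y : 'cV[F]_n) : x != 0 -> exists A, A *m x = y.
Proof.
move=> /matrix0Pn[k [j]]; rewrite (ord1 j) => xk.
exists ((x k 0)^-1 *: (y *m delta_mx 0 k)).
rewrite -scalemxAl -mulmxA -rowE [row k x]mx11_scalar mul_mx_scalar mxE.
by rewrite scalerA mulVf // scale1r.
Qed.

(** A nonzero matrix in [I] can be multiplied to one whose only nonzero column
    is the last: by an elementary matrix on the right if its first [n] columns
    are not all zero.  Left multiplication then produces every last column. *)
Lemma nonzero_ideal_socle (I : ideal R) : nonzero_ideal I ->
  forall v, (I : set R) (g (row_mx 0 v)).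
Proof.
move=> nzI v; have [[I0 IB IM] [_ _ IMr]] := (ideal_left I, ideal_right I).
have [X IX X0] : exists2 X, (I : set R) (g X) & X != 0.
  apply: contrapT => nX; apply: nzI; apply/seteqP; split=> r; last by move=> ->.
  have [X <-] := sandwich_surj sg r => IX; apply: contrapT => gX; apply: nX.
  exists X => //; apply/eqP => X0; apply: gX.
  by rewrite X0 /= (sandwich0 sg).
suff [u u0 Iu] : exists2 u, u != 0 & (I : set R) (g (row_mx 0 u)).
  have [A Au] := mulmx_transitive v u0.
  have := IM (g (row_mx A 0)) _ Iu.
  by rewrite (sandwich_mull sg) mul_mx_row mulmx0 Au.
have [Xl0|/matrix0Pn[i [j Xij]]] := eqVneq (lsubmx X) 0.
  exists (rsubmx X); last by rewrite -Xl0 hsubmxK.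
  by apply: contraNneq X0 => Xr0; rewrite -[X]hsubmxK Xl0 Xr0 row_mx0.
exists (col j (lsubmx X)).
  by apply/matrix0Pn; exists i, 0; rewrite mxE.
have := IMr (g (row_mx 0 (delta_mx j 0))) _ IX.
by rewrite (sandwichM sg) mul_mx_row mulmx0 -colE.
Qed.

Lemma nonzero_ideal_no_cover (I : ideal R) (D : set (set R)) :
  nonzero_ideal I -> proper_cover left_ideal D ->
  ~ forall L, D L -> (I : set R) `<=` L.
Proof.
move=> nzI [JD cD] ID.
have : [set: R] (g (row_mx 1%:M 0)) by [].
rewrite -cD => -[L DL L1]; have [idL nL] := JD L DL.
have sgL := left_ideal_subgroup idL.
apply: nL; rewrite -subTset => r _; have [X <-] := sandwich_surj sg r.
have -> : X = lsubmx X *m row_mx 1%:M 0 + row_mx 0 (rsubmx X).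
  by rewrite mul_mx_row mulmx1 mulmx0 add_row_mx addr0 add0r hsubmxK.
rewrite (sandwichD sg) -(sandwich_mull sg); apply: (subgD sgL).
  exact: left_idealM.
by apply: ID => //; exact: nonzero_ideal_socle.
Qed.

Lemma hyperplanes_card :
  hyperplanes #= `I_((#|F| ^ n.+1 - 1) %/ (#|F| - 1)).
Proof.
have q1 : (0 < #|F| - 1)%N.
  by rewrite subn_gt0; apply: finalg.card_finNzRing_gt1.
rewrite -addn1 -(card_points F (n + 1)) mulnK //.
set P := points F (n + 1).
have -> : hyperplanes = (fun i : 'I_#|P| => annihilator g (enum_val i)) @` setT.
  apply/seteqP; split=> [_ [c /= c0 <-]|_ [i _ <-]].
    have [a a0 nc] := normalize_eq c0.
    exists (enum_rank_in (normalize_points c0) (normalize c)) => //=.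
    by rewrite enum_rankK_in ?normalize_points // nc annihilatorZ.
  by exists (enum_val i) => //=; have := enum_valP i; rewrite inE => /andP[].
apply: (card_eq_trans (inj_card_eq _)); last by rewrite card_eq_sym card_II.
move=> i j _ _ e; apply: enum_val_inj.
have := enum_valP j; have := enum_valP i.
set c := enum_val i; set c' := enum_val j => cP c'P.
have c0 : c != 0 by move: cP; rewrite inE => /andP[].
have c'0 : c' != 0 by move: c'P; rewrite inE => /andP[].
have [T [Tc Tz _]] := line_kernel_matrix (addn1 n) c'0.
have /(annihilatorP sg)/Tz[a ca] : annihilator g c (g T).
  by rewrite e; apply/(annihilatorP sg).
apply: (points_inj c'P cP _ ca).
by apply/eqP => a0; move: c0; rewrite ca a0 scale0r eqxx.
Qed.

End ColumnExtension.

(** * Block matrices *)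

Lemma col_extensionE (F : pzRingType) n :
  col_extension F n = (fun X : 'M[F]_(n, n + 1) => col_mx X 0) @` setT.
Proof.
apply/seteqP; split=> [_ [A _ [v _ <-]]|_ [X _ <-]].
  by exists (row_mx A v) => //; rewrite block_mxEv row_mx0.
exists (lsubmx X) => //; exists (rsubmx X) => //.
by rewrite block_mxEv row_mx0 hsubmxK.
Qed.

Lemma col_mx_mul0 (F : pzRingType) n (X Y : 'M[F]_(n, n + 1)) :
  col_mx X (0 : 'M_(1, _)) *m col_mx Y 0 = col_mx (lsubmx X *m Y) 0.
Proof.
by rewrite mul_col_mx mul0mx -{1}[X]hsubmxK mul_row_col mulmx0 addr0.
Qed.

Lemma sandwich_col_extension (R : rngType) (F : finFieldType) n :
  rng_iso_subset R (col_extension F n) <->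
  exists g : 'M[F]_(n, n + 1) -> R, sandwich g.
Proof.
rewrite col_extensionE; split=> [[f [fD fM [fS finj fsurj]]]|[g [[h gK hK] gD gM]]].
  have hf r : exists X : 'M_(n, n + 1), col_mx X 0 = f r.
    by have [X _ e] := fS r I; exists X.
  have [h hP] := choice hf.
  have gex (X : 'M_(n, n + 1)) : exists r, f r = col_mx X 0.
    by have [|r _ e] := fsurj (col_mx X 0); [exists X|exists r].
  have [g gP] := choice gex.
  have fI r s : f r = f s -> r = s by apply: finj; rewrite inE.
  exists g; split.
  - exists h => [X|r]; last by apply: fI; rewrite gP hP.
    by have := hP (g X); rewrite gP => /eq_col_mx[].
  - by move=> X Y; apply: fI; rewrite fD !gP add_col_mx addr0.
  - by move=> X Y; apply: fI; rewrite fM !gP -col_mx_mul0.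
have hD r s : h (r + s) = h r + h s.
  by apply: (can_inj gK); rewrite gD !hK.
have hM r s : h (rmul r s) = lsubmx (h r) *m h s.
  by apply: (can_inj gK); rewrite gM !hK.
exists (fun r => col_mx (h r) 0); split=> [r s|r s|].
- by rewrite hD add_col_mx addr0.
- by rewrite hM -col_mx_mul0.
split=> [r _|r s _ _ /eq_col_mx[/(can_inj hK)]//|_ [X _ <-]].
  by exists (h r).
by exists (g X) => //; rewrite gK.
Qed.

(** * The opposite ring and the classification *)

(** A copy of the carrier, to hold the second product. *)
Definition opposite (R : rngType) : Type := R.

Section Opposite.
Variable R : rngType.
Local Notation Rop := (opposite R).
HB.instance Definition _ := GRing.Zmodule.on Rop.

Definition opposite_mul (x y : Rop) : Rop := rmul (y : R) (x : R).
Lemma opposite_mulA : associative opposite_mul.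
Proof. by move=> x y z; rewrite /opposite_mul rmulA. Qed.
Lemma opposite_mulDl : left_distributive opposite_mul +%R.
Proof. by move=> x y z; exact: rmulDr. Qed.
Lemma opposite_mulDr : right_distributive opposite_mul +%R.
Proof. by move=> x y z; exact: rmulDl. Qed.
HB.instance Definition _ := Zmodule_isRng.Build Rop opposite_mulA
  opposite_mulDl opposite_mulDr.

Lemma tight_opposite k :
  tight right_ideal R k -> tight left_ideal (Rop : rngType) k.
Proof.
case=> exH irr noI; split=> //.
by move=> I H; exact: (noI (@Ideal R I (ideal_right I) (ideal_left I))).
Qed.

Lemma row_extension_opposite (F : finFieldType) n :
  rng_iso_subset R (row_extension F n) <->
  rng_iso_subset (Rop : rngType) (col_extension F n).
Proof.
have trE (A : 'M[F]_n) (v : 'cV[F]_n) :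
    (block_mx A 0 v^T (0 : 'M_1))^T = block_mx A^T v 0 0.
  by rewrite tr_block_mx trmxK !trmx0.
have trE' (A : 'M[F]_n) (v : 'cV[F]_n) :
    (block_mx A v 0 (0 : 'M_1))^T = block_mx A^T 0 v^T 0.
  by rewrite tr_block_mx !trmx0.
split=> -[f [fD fM [fS finj fsurj]]].
  exists (fun r => (f r)^T); split=> [r s|r s|].
  - by rewrite fD raddfD.
  - by rewrite fM trmx_mul.
  split=> [r _|r s Rr Rs /trmx_inj|_ [A _ [v _ <-]]].
  - have [A _ [v _ <-]] := fS r I.
    by exists A^T => //; exists v => //; rewrite trE.
  - exact: finj.
  - have [|r _ fr] := fsurj (block_mx A^T 0 v^T 0).
      by exists A^T => //; exists v.
    by exists r => //; rewrite fr trE trmxK.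
exists (fun r => (f r)^T); split=> [r s|r s|].
- by rewrite fD raddfD.
- by rewrite (fM s r) trmx_mul.
split=> [r _|r s Rr Rs /trmx_inj|_ [A _ [v _ <-]]].
- have [A _ [v _ <-]] := fS r I.
  by exists A^T => //; exists v => //; rewrite trE'.
- exact: finj.
- have [|r _ fr] := fsurj (block_mx A^T v 0 0).
    by exists A^T => //; exists v.
  by exists r => //; rewrite fr trE' trmxK.
Qed.
End Opposite.

Lemma tight_col_extension (R : rngType) k : noncommutative R ->
  tight left_ideal R k ->
  exists (F : finFieldType) n, (0 < n)%N /\ rng_iso_subset R (col_extension F n).
Proof.
move=> ncR tR; have [F [n [m [g sg]]]] := tight_sandwich ncR tR.
have n0 : (0 < n)%N.
  rewrite lt0n; apply/eqP => n0; subst n.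
  have [x [y xy]] := ncR; apply: xy.
  have [X <-] := sandwich_surj sg (rmul x y).
  have [Y <-] := sandwich_surj sg (rmul y x).
  by rewrite [X]flatmx0 [Y]flatmx0.
have m1 := tight_sandwich_width sg n0 tR; subst m.
by exists F, n; split=> //; apply/sandwich_col_extension; exists g.
Qed.

Lemma card_finField_prime_power (F : finFieldType) : prime_power #|F|.
Proof.
have [p p_pr pcharFp] := finPcharP F.
have := card_pprimeChar pcharFp; set k := logn _ _ => cF.
exists p, k; split=> //; rewrite lt0n; apply/eqP => k0.
by have := finalg.card_finNzRing_gt1 F; rewrite cF k0.
Qed.

Lemma noncommutative_nonzero_ideal (R : rngType) : noncommutative R ->
  exists I : ideal R, nonzero_ideal I.
Proof.
move=> [x [y xy]].
have idl : left_ideal [set: R] by [].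
have idr : right_ideal [set: R] by [].
exists (Ideal idl idr); rewrite /nonzero_ideal /= => e; apply: xy.
have all0 z : z = 0 :> R by have : [set: R] z by []; rewrite e.
by rewrite (all0 x) (all0 y).
Qed.

Lemma eta_elementary_left_forward (R : rngType) : noncommutative R ->
  eta_elementary left_ideal R ->
  exists (F : finFieldType) n, (0 < n)%N /\ rng_iso_subset R (col_extension F n).
Proof.
move=> ncR /(eta_elementary_tight left_ideal_quotient_stable).
case=> [|k tR]; first exact: noncommutative_nonzero_ideal.
exact: tight_col_extension tR.
Qed.

Lemma eta_elementary_right_forward (R : rngType) : noncommutative R ->
  eta_elementary right_ideal R ->
  exists (F : finFieldType) n, (0 < n)%N /\ rng_iso_subset R (row_extension F n).
Proof.
move=> ncR /(eta_elementary_tight right_ideal_quotient_stable).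
case=> [|k /tight_opposite tR]; first exact: noncommutative_nonzero_ideal.
have ncRop : noncommutative (opposite R : rngType).
  by have [x [y xy]] := ncR; exists y, x.
have [F [n [n0 iso]]] := tight_col_extension ncRop tR.
by exists F, n; split=> //; exact/row_extension_opposite.
Qed.

Lemma col_extension_cover (R : rngType) (F : finFieldType) n : (0 < n)%N ->
  rng_iso_subset R (col_extension F n) ->
  exists C : set (set R), [/\ min_cover left_ideal C,
    C #= `I_((#|F| ^ n.+1 - 1) %/ (#|F| - 1)) &
    forall (I : ideal R) (D : set (set R)), nonzero_ideal I ->
      proper_cover left_ideal D -> ~ forall L, D L -> (I : set R) `<=` L].
Proof.
move=> n0 /sandwich_col_extension[g sg]; exists (hyperplanes g); split.
- exact: hyperplanes_min_cover.
- exact: hyperplanes_card.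
- exact: nonzero_ideal_no_cover sg.
Qed.

Lemma row_extension_cover (R : rngType) (F : finFieldType) n : (0 < n)%N ->
  rng_iso_subset R (row_extension F n) ->
  exists C : set (set R), [/\ min_cover right_ideal C,
    C #= `I_((#|F| ^ n.+1 - 1) %/ (#|F| - 1)) &
    forall (I : ideal R) (D : set (set R)), nonzero_ideal I ->
      proper_cover right_ideal D -> ~ forall L, D L -> (I : set R) `<=` L].
Proof.
move=> n0 /row_extension_opposite/(col_extension_cover n0)[C [minC cC noD]].
exists C; split=> // I.
exact: (noD (@Ideal (opposite R) I (ideal_right I) (ideal_left I))).
Qed.

Local Close Scope quotient_scope.
Local Close Scope ring_scope.
Local Close Scope card_scope.
Local Close Scope classical_set_scope.

Theorem theorem1p3 (R : rngType) (hR : noncommutative R) :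
  ((eta_elementary left_ideal R <->
      exists (q n : nat) (F : finFieldType),
        [/\ prime_power q, 1 <= n, #|F| = q &
            rng_iso_subset R (col_extension F n)]) /\
   (forall (q n : nat) (F : finFieldType),
      prime_power q -> 1 <= n -> #|F| = q ->
      rng_iso_subset R (col_extension F n) ->
      eta_eq left_ideal R ((q ^ n.+1 - 1) %/ (q - 1)))) /\
  ((eta_elementary right_ideal R <->
      exists (q n : nat) (F : finFieldType),
        [/\ prime_power q, 1 <= n, #|F| = q &
            rng_iso_subset R (row_extension F n)]) /\
   (forall (q n : nat) (F : finFieldType),
      prime_power q -> 1 <= n -> #|F| = q ->
      rng_iso_subset R (row_extension F n) ->
      eta_eq right_ideal R ((q ^ n.+1 - 1) %/ (q - 1)))).
Proof.
have finC q n (C : set (set R)) : card_eq C `I_((q ^ n.+1 - 1) %/ (q - 1)) ->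
  finite_set C by move=> cC; eexists; exact: cC.
split; split.
- split=> [/(eta_elementary_left_forward hR)[F [n [n0 iso]]]|].
    by exists #|F|, n, F; split=> //; exact: card_finField_prime_power.
  move=> [q [n [F [_ n0 _ /(col_extension_cover n0)[C [minC cC noD]]]]]].
  exact: eta_elementary_of_no_cover left_ideal_quotient_stable minC (finC _ _ _ cC) noD.
- move=> q n F _ n0 <- /(col_extension_cover n0)[C [minC cC _]].
  by exists C.
- split=> [/(eta_elementary_right_forward hR)[F [n [n0 iso]]]|].
    by exists #|F|, n, F; split=> //; exact: card_finField_prime_power.
  move=> [q [n [F [_ n0 _ /(row_extension_cover n0)[C [minC cC noD]]]]]].
  exact: eta_elementary_of_no_cover right_ideal_quotient_stable minC (finC _ _ _ cC) noD.
- move=> q n F _ n0 <- /(row_extension_cover n0)[C [minC cC _]].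
  by exists C.
Qed.
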